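(* Let $A$ be a self-adjoint operator on a Hilbert space $\mathcal{H}$, let $\varphi\in\mathcal{H}_{-2}\setminus\mathcal{H}$, let $c\in\mathbb{R}$ be fixed, and let $A_{\alpha,c}=A+\alpha\langle\varphi_c,\cdot\rangle\varphi$ for $\alpha\in\mathbb{R}$. Suppose that $(A+iI)^{-1}\varphi$ is cyclic for $A$. Then the set $$\{x\in\sigma(A): x\notin\sigma_p(A_{\alpha,c})\ \forall\,\alpha\in\mathbb{R}\setminus\{0\}\}$$ contains a dense $G_\delta$ subset of $\sigma(A)$, and the set $$\{\alpha\in\mathbb{R} : \sigma_p(A_{\alpha,c})\cap\sigma(A)=\varnothing\}$$ contains a dense $G_\delta$ subset of $\mathbb{R}$.
   Context: $\mathcal{H}$ is a complex Hilbert space, with inner product conjugate-linear in the first argument. For $s\ge 0$, $\mathcal{H}_s=D(|A|^{s/2})$ with norm $\|x\|_s=\|(|A|+I)^{s/2}x\|$, and $\mathcal{H}_{-s}$ is the completion of $\mathcal{H}$ in the norm $\|(|A|+I)^{-s/2}x\|$, identified with the space of bounded functionals on $\mathcal{H}_s$; so $\mathcal{H}_2=D(A)$, and for $\varphi\in\mathcal{H}_{-2}$, $x\in\mathcal{H}_2$, $\langle\varphi,x\rangle$ is the duality pairing, extending the inner product by continuity. For $\varphi\in\mathcal{H}_{-2}$, $(A\pm iI)^{-1}\varphi\in\mathcal{H}$ is defined in the generalized sense: $\langle (A\pm iI)^{-1}\varphi,\eta\rangle=\langle\varphi,(A\mp iI)^{-1}\eta\rangle$ for all $\eta\in\mathcal{H}$.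 Put $A(A^2+I)^{-1}\varphi:=\frac12[(A-iI)^{-1}\varphi+(A+iI)^{-1}\varphi]\in\mathcal{H}$. Let $\varphi\in\mathcal{H}_{-2}\setminus\mathcal{H}$. The operator $\dot A:=A\upharpoonright_{D(\dot A)}$, $D(\dot A)=\{x\in D(A):\langle\varphi,x\rangle=0\}$, is a densely defined closed symmetric operator with deficiency indices $(1,1)$, and $D(\dot A^* )=D(A)\dotplus\mathrm{span}\{A(A^2+I)^{-1}\varphi\}$. For $c\in\mathbb{R}$, the functional $\varphi_c$ on $D(\dot A^* )$ extends $\varphi$ by $\langle\varphi_c,x+bA(A^2+I)^{-1}\varphi\rangle=\langle\varphi,x\rangle+bc$ for $x\in D(A)$, $b\in\mathbb{C}$. For $\alpha\in\mathbb{R}$ the formal expression $A_{\alpha,c}=A+\alpha\langle\varphi_c,\cdot\rangle\varphi$ denotes the self-adjoint operator obtained by restricting $\dot A^*$ to $$D(A_{\alpha,c})=\{x+bA(A^2+I)^{-1}\varphi : x\in D(A),\ b\in\mathbb{C},\ b+\alpha(\langle\varphi,x\rangle+bc)=0\}$$ (for $\alpha\ne0$ the condition reads $\langle\varphi,x\rangle=\gamma b$ with $\gamma=-(\frac1\alpha+c)$; and $A_{0,c}=A$). A vector $u\in\mathcal{H}$ is cyclic for $A$ if $\overline{\mathrm{span}\{(A-zI)^{-1}u:z\in\mathbb{C}\setminus\mathbb{R}\}}=\mathcal{H}$. $\sigma$ denotes spectrum and $\sigma_p$ the set of eigenvalues. *)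

(* Defs.v *)
From HB Require Import structures.
From mathcomp Require Import all_boot all_order all_algebra.
From mathcomp Require Import all_classical all_reals all_analysis borel_hierarchy.
From mathcomp Require Import complex.

Set Implicit Arguments.
Unset Strict Implicit.
Unset Printing Implicit Defensive.

Import Order.TTheory GRing.Theory Num.Theory.
Import numFieldNormedType.Exports.

Local Open Scope classical_set_scope.
Local Open Scope ring_scope.

(* The order and the norms over R[i] take values in R[i]: x <= y means that
   y - x is a nonnegative real. The topology of the field of complex numbers
   is the one of R[i]^o. The inner product is linear in the second argument,
   hence conjugate-linear in the first one. *)
HB.mixin Record CompleteNormedModule_isHilbert (R : realType) (H : Type)
    & CompleteNormedModule R[i] H := {
  inner : H -> H -> R[i] ;
  innerDr : forall x y z : H, inner x (y + z) = inner x y + inner x z ;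
  innerZr : forall (a : R[i]) (x y : H), inner x (a *: y) = a * inner x y ;
  innerC : forall x y : H, inner y x = (inner x y)^* ;
  innerxx : forall x : H, inner x x = `|x| ^+ 2 }.

#[short(type="hilbertType")]
HB.structure Definition Hilbert (R : realType) :=
  {H of CompleteNormedModule_isHilbert R H & CompleteNormedModule R[i] H}.

Section UnboundedOperators.
Context {R : realType} {H : hilbertType R}.
Local Notation C := R[i].

(* Only the values of op_fun on dom are meaningful. *)
Record operator := Operator { dom : set H ; op_fun :> H -> H }.

Definition op_eq (S T : operator) : Prop :=
  dom S = dom T /\ forall x, dom T x -> S x = T x.

Definition linear_on (V : lmodType C) (D : set H) (f : H -> V) : Prop :=
  D 0 /\ forall (a : C) (x y : H), D x -> D y ->
    D (a *: x + y) /\ f (a *: x + y) = a *: f x + f y.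

Definition linear_operator (T : operator) : Prop := linear_on (dom T) T.

Definition op_restrict (T : operator) (D : set H) : operator := Operator D T.

Definition op_square (T : operator) : operator :=
  Operator [set x | dom T x /\ dom T (T x)] (fun x => T (T x)).

Definition adjoint_val (T : operator) (y : H) : set H :=
  [set z | forall x, dom T x -> inner y (T x) = inner z x].

(* The value z is unique when dom T is dense. *)
Definition adjoint (T : operator) : operator :=
  Operator [set y | adjoint_val T y !=set0]
           (fun y => xget 0 (adjoint_val T y)).

Definition self_adjoint (T : operator) : Prop :=
  [/\ linear_operator T, dense (dom T) & op_eq (adjoint T) T].

Definition nonnegative (T : operator) : Prop :=
  forall x, dom T x -> 0 <= inner x (T x).

(* B = |T|, the unique nonnegative self-adjoint square root of T^2 (for T
   self-adjoint). *)
Definition is_abs (T B : operator) : Prop :=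
  [/\ self_adjoint B, nonnegative B & op_eq (op_square B) (op_square T)].

Definition resolvent_eq (T : operator) (z : C) (y : H) : set H :=
  [set x | dom T x /\ T x - z *: x = y].

(* (T - zI)^-1 y *)
Definition resolvent (T : operator) (z : C) (y : H) : H :=
  xget 0 (resolvent_eq T z y).

(* T - zI is a bijection from dom T onto H with bounded inverse. *)
Definition resolvent_set (T : operator) : set C^o :=
  [set z | (forall y, exists! x, resolvent_eq T z y x) /\
           exists M : R, forall x, dom T x -> `|x| <= M%:C%C * `|T x - z *: x|].

Definition spectrum (T : operator) : set C^o := ~` resolvent_set T.

Definition point_spectrum (T : operator) : set C^o :=
  [set z | exists x, [/\ dom T x, x != 0 & T x = z *: x]].

Definition linear_span (S : set H) : set H :=
  [set v | exists (n : nat) (a : 'I_n -> C) (s : 'I_n -> H),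
     (forall k, S (s k)) /\ v = \sum_(k < n) a k *: s k].

Definition cyclic_vector (T : operator) (u : H) : Prop :=
  closure (linear_span [set resolvent T z u | z in [set z | z \isn't Num.real]])
    = setT.

(* An element phi of H_{-2} is identified with the functional x |-> <phi, x>
   on H_2 = D(|A|) (= D(A)), which is linear and bounded for the norm
   ||(|A| + I)x||. It is encoded by a total function on H, whose values
   outside D(A) are irrelevant. *)
Definition in_Hm2 (A : operator) (phi : H -> C) : Prop :=
  exists B : operator,
    [/\ is_abs A B, linear_on (dom B) (phi : H -> C^o) &
        exists M : R, forall x, dom B x -> `|phi x| <= M%:C%C * `|B x + x|].

(* Elements of H, as elements of H_{-2}. *)
Definition in_H (A : operator) (phi : H -> C) : Prop :=
  exists u : H, forall x, dom A x -> phi x = inner u x.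

(* (A - zI)^-1 phi, for phi in H_{-2}: the vector u of H such that
   <u, eta> = <phi, (A - z^* I)^-1 eta> for all eta. *)
Definition gen_resolvent (A : operator) (phi : H -> C) (z : C) : H :=
  xget 0 [set u | forall eta, inner u eta = phi (resolvent A z^* eta)].

(* A (A^2 + I)^-1 phi *)
Definition sing_vec (A : operator) (phi : H -> C) : H :=
  2^-1 *: (gen_resolvent A phi 'i + gen_resolvent A phi (- 'i)).

Definition dotA (A : operator) (phi : H -> C) : operator :=
  op_restrict A [set x | dom A x /\ phi x = 0].

(* A + alpha <phi_c, .> phi; here phi x + b * c is the value of phi_c at
   x + b A (A^2 + I)^-1 phi. *)
Definition rank_one_pert (A : operator) (phi : H -> C) (c alpha : R) :
    operator :=
  op_restrict (adjoint (dotA A phi))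
    [set y | exists (x : H) (b : C),
       [/\ dom A x, y = x + b *: sing_vec A phi &
           b + alpha%:C%C * (phi x + b * c%:C%C) = 0]].

End UnboundedOperators.

(* The subset E of T contains a dense G_delta subset of the topological
   subspace S: the G_delta subsets of S are the S `&` U, U a G_delta of T. *)
Definition contains_dense_Gdelta_of (T : topologicalType) (S E : set T) : Prop :=
  exists U : set T,
    [/\ Gdelta U, S `&` U `<=` E & S `<=` closure (S `&` U)].

(* Main.v *)
Require Import Defs.
From HB Require Import structures.
From mathcomp Require Import all_boot all_order all_algebra.
From mathcomp Require Import all_classical all_reals all_analysis borel_hierarchy.
From mathcomp Require Import complex.
From mathcomp Require Import ring lra.

Set Implicit Arguments.
Unset Strict Implicit.
Unset Printing Implicit Defensive.

Import Order.TTheory GRing.Theory Num.Theory.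
Import numFieldNormedType.Exports.

Local Open Scope classical_set_scope.
Local Open Scope ring_scope.

(** Eigenvalues of the perturbed operators inside the spectrum of A are governed
    by the weak equation (A - s)y = phi. Let s be a real spectral point that is an
    eigenvalue of the operator with coupling alpha <> 0. Since phi is not in H and
    the resolvent of phi is cyclic, a multiple y of the eigenvector satisfies
    <y, (A - s)x> = phi x on the domain of A, and the boundary condition reads
    G(s) = - 1 / alpha - c, where G(s) = Re phi(y - A(A^2 + I)^-1 phi) depends on
    s only (eigenvalue_weak_sol). By Riesz, a solution y of norm at most n exists
    exactly when |phi x| <= n |(A - s)x| for all x; so the set E_n of spectral
    points where this holds is closed.

    The E_n are nowhere dense in the spectrum (local_regular). In terms of the
    spectral measure mu, E_n consists of the spectral points s where the integral
    of (u - s)^-2 dmu(u) is at most n^2; if this held on all of the spectrum in an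
    interval, short pieces of length h would have mass O(h^2), and the interval
    would have mass zero. Instead of spectral measures, the proof uses
    the discrete Fourier transform of the Cayley transform of A
    (unitary_local_bound), preceded by the fact that the resolvent at a real point
    is controlled by the distance to the spectrum (dist_spectrum_bound). The Baire
    category theorem in the spectrum then gives the first assertion.

    For the second assertion, the resolvent identity gives
    G(s) - G(t) = (s - t) Re <y_s, y_t>. Hence G is Lipschitz on E_n, and near each
    of its points it increases at a positive rate, because y_t tends weakly to y_s
    inside E_n. A set E_n contains no interval; as G is continuous and strictly
    increasing on countably many compact pieces that cover the union of the E_n,
    the image of each piece is closed without interior (meager_image). The
    couplings alpha <> 0 for which - 1 / alpha - c avoids all of these images form
    a dense G_delta set, by the Baire category theorem on the line. *)

(** * Real-valued norms and the inner product *)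
Section RealNorm.
Context {R : realType}.
Local Notation C := R[i].

(** The norms of the complex spaces at hand take values in R[i], whose order is
    only partial; estimates are carried out on this real-valued version, where
    the order is total. *)
Definition nrm (V : normedZmodType C) (x : V) : R := complex.Re `|x|.

Lemma nrmC (V : normedZmodType C) (x : V) : `|x| = (nrm x)%:C%C.
Proof. by rewrite RRe_real // normr_real. Qed.

Section Basic.
Context {V : normedZmodType C}.
Implicit Types x y z : V.

Lemma nrm_ge0 x : 0 <= nrm x.
Proof. by rewrite -ler0c -nrmC normr_ge0. Qed.

Lemma nrm_eq0 x : (nrm x == 0) = (x == 0).
Proof.
rewrite -[RHS]normr_eq0 nrmC; apply/eqP/eqP => [->//|h].
by apply: complexI; rewrite h.
Qed.

Lemma nrm0 : nrm (0 : V) = 0.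
Proof. by apply/eqP; rewrite nrm_eq0. Qed.

Lemma nrmD x y : nrm (x + y) <= nrm x + nrm y.
Proof. by rewrite -lecR rmorphD /= -!nrmC ler_normD. Qed.

Lemma nrmN x : nrm (- x) = nrm x.
Proof. by rewrite /nrm normrN. Qed.

Lemma nrm_distC x y : nrm (x - y) = nrm (y - x).
Proof. by rewrite -nrmN opprB. Qed.

Lemma nrm_tri x y z : nrm (x - z) <= nrm (x - y) + nrm (y - z).
Proof. by apply: le_trans (nrmD _ _); rewrite addrA subrK. Qed.

Lemma nrm_sub_ge x y : nrm x - nrm y <= nrm (x - y).
Proof. by rewrite lerBlDr; apply: le_trans (nrmD _ _); rewrite subrK. Qed.

End Basic.

Lemma nrmM (a b : C) : nrm (a * b) = nrm a * nrm b.
Proof. by apply: complexI; rewrite rmorphM /= -!nrmC normrM. Qed.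

Lemma nrmX (a : C) n : nrm (a ^+ n) = nrm a ^+ n.
Proof. by apply: complexI; rewrite rmorphXn /= -!nrmC normrX. Qed.

Lemma nrmV (a : C) : nrm a^-1 = (nrm a)^-1.
Proof. by apply: complexI; rewrite fmorphV /= -!nrmC normfV. Qed.

Lemma nrm1 : nrm (1 : C) = 1.
Proof. by rewrite /nrm normr1. Qed.

Lemma nrm_conj (a : C) : nrm a^* = nrm a.
Proof. by rewrite /nrm norm_conjC. Qed.

Lemma nrm_real (x : R) : nrm (x%:C%C : C) = `|x|.
Proof. by rewrite /nrm normc_def /= expr0n addr0 sqrtr_sqr. Qed.

Lemma conj_real (x : R) : (x%:C%C : C)^* = x%:C%C.
Proof. by rewrite -[_^*]/(x%:C^*)%C conjc_real. Qed.

Lemma nrm_i : nrm ('i : C) = 1.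
Proof. by rewrite /nrm normCi. Qed.

Lemma nrm_nat n : nrm (n%:R : C) = n%:R.
Proof. by rewrite -[n%:R in LHS](rmorph_nat (real_complex R)) nrm_real normr_nat. Qed.

Lemma nrm_sq (a : C) : nrm a ^+ 2 = complex.Re a ^+ 2 + complex.Im a ^+ 2.
Proof. by apply: complexI; rewrite rmorphXn /= -nrmC add_Re2_Im2. Qed.

Lemma Re_le_nrm (a : C) : complex.Re a <= nrm a.
Proof.
apply: le_trans (ler_norm _) _; rewrite -(ler_pXn2r (ltn0Sn 1)) ?nnegrE ?nrm_ge0 //.
by rewrite nrm_sq real_normK ?num_real // lerDl sqr_ge0.
Qed.

Lemma cRe_conj (a : C) : complex.Re a^* = complex.Re a.
Proof. by case: a. Qed.
Lemma cIm_conj (a : C) : complex.Im a^* = - complex.Im a.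
Proof. by case: a. Qed.
Lemma cRe_add (a b : C) : complex.Re (a + b) = complex.Re a + complex.Re b.
Proof. by case: a b => ? ? []. Qed.
Lemma cRe_opp (a : C) : complex.Re (- a) = - complex.Re a.
Proof. by case: a. Qed.
Lemma cRe_mulr (x : R) (a : C) : complex.Re (x%:C%C * a) = x * complex.Re a.
Proof. by case: a => a b /=; rewrite mul0r subr0. Qed.
Lemma cRe_muli (a : C) : complex.Re ('i * a) = - complex.Im a.
Proof. by rewrite mulrC -complexiE ReiNIm. Qed.
Lemma complex_eqP (a b : C) :
  complex.Re a = complex.Re b -> complex.Im a = complex.Im b -> a = b.
Proof. by case: a b => ? ? [? ?] /= -> ->. Qed.

Lemma Im_nonreal (z : C) : z \isn't Num.real -> complex.Im z != 0.
Proof. by apply: contra; case: z => a b /= /eqP ->; rewrite complex_real. Qed.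

Lemma mulii : 'i * 'i = -1 :> C.
Proof. by rewrite -expr2 sqrCi. Qed.

End RealNorm.

Section HilbertBasics.
Context {R : realType} {H : hilbertType R}.
Local Notation C := R[i].
Implicit Types x y z : H.

Lemma nrmZ (a : C) x : nrm (a *: x) = nrm a * nrm x.
Proof. by apply: complexI; rewrite rmorphM /= -!nrmC normrZ. Qed.

Lemma inner0r x : inner x 0 = 0.
Proof. by rewrite -[0 : H](scale0r (0 : H)) innerZr mul0r. Qed.
Lemma innerNr x y : inner x (- y) = - inner x y.
Proof. by rewrite -scaleN1r innerZr mulN1r. Qed.
Lemma innerDl x y z : inner (x + y) z = inner x z + inner y z.
Proof. by rewrite innerC innerDr rmorphD /= -!innerC. Qed.
Lemma innerZl (a : C) x y : inner (a *: x) y = a^* * inner x y.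
Proof. by rewrite innerC innerZr rmorphM /= -!innerC. Qed.
Lemma innerNl x y : inner (- x) y = - inner x y.
Proof. by rewrite innerC innerNr rmorphN /= -innerC. Qed.
Lemma inner0l x : inner 0 x = 0.
Proof. by rewrite innerC inner0r rmorph0. Qed.
Definition innerE := (@innerDr R H, innerDl, innerNr, innerNl, @innerZr R H, innerZl, inner0r, inner0l).

Lemma nrm2E x : nrm x ^+ 2 = complex.Re (inner x x).
Proof. by rewrite innerxx nrmC -rmorphXn. Qed.

Lemma innerxxE x : inner x x = (nrm x ^+ 2)%:C%C.
Proof. by rewrite innerxx nrmC -rmorphXn. Qed.

Lemma inner_eq0 x : inner x x = 0 -> x = 0.
Proof.
by rewrite innerxx => /eqP; rewrite sqrf_eq0 normr_eq0 => /eqP.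
Qed.

(** Vector identities are reduced to scalar identities by pairing with an
    arbitrary vector; the latter fall to ring and field. *)
Lemma inner_extr x y : (forall z, inner z x = inner z y) -> x = y.
Proof.
move=> h; apply/eqP; rewrite -subr_eq0; apply/eqP/inner_eq0.
by rewrite innerDr innerNr h subrr.
Qed.

Lemma Re_innerC x y : complex.Re (inner x y) = complex.Re (inner y x).
Proof. by rewrite innerC cRe_conj. Qed.

Lemma nrm2D x y :
  nrm (x + y) ^+ 2 = nrm x ^+ 2 + complex.Re (inner x y) *+ 2 + nrm y ^+ 2.
Proof.
rewrite !nrm2E !innerE !cRe_add (Re_innerC y x); ring.
Qed.

Lemma Re_inner_le x y : complex.Re (inner x y) <= nrm x * nrm y.
Proof.
have [->|y0] := eqVneq y 0; first by rewrite inner0r nrm0 mulr0.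
have ny : 0 < nrm y by rewrite lt_def nrm_eq0 y0 nrm_ge0.
have [->|x0] := eqVneq x 0; first by rewrite inner0l nrm0 mul0r.
have nx : 0 < nrm x by rewrite lt_def nrm_eq0 x0 nrm_ge0.
have := sqr_ge0 (nrm ((nrm y)%:C%C *: x + - ((nrm x)%:C%C *: y))).
rewrite nrm2D nrmN !nrmZ !nrm_real !ger0_norm ?nrm_ge0 //.
rewrite innerNr innerZr innerZl conj_real cRe_opp !cRe_mulr => h.
have : 0 <= (nrm x * nrm y * 2) * (nrm x * nrm y - complex.Re (inner x y)).
  by apply: le_trans h _; rewrite le_eqVlt; apply/orP; left; apply/eqP; ring.
by rewrite pmulr_rge0 ?subr_ge0 // !mulr_gt0.
Qed.

Lemma inner_le_nrm x y : nrm (inner x y) <= nrm x * nrm y.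
Proof.
have [->|h0] := eqVneq (inner x y) 0; first by rewrite nrm0 mulr_ge0 ?nrm_ge0.
set a := inner x y in h0 *.
have na : 0 < nrm a by rewrite lt_def nrm_eq0 h0 nrm_ge0.
have := Re_inner_le (a *: x) y.
rewrite innerZl -/a mulrC -normCK nrmC -rmorphXn /= nrmZ -mulrA.
by rewrite expr2 ler_pM2l.
Qed.

(** The expansion behind every first-variation and quadratic-form argument
    below. *)
Lemma nrm_lincomb (t : R) x y :
  nrm (x + t%:C%C *: y) ^+ 2 =
  nrm x ^+ 2 + t * complex.Re (inner x y) *+ 2 + t ^+ 2 * nrm y ^+ 2.
Proof.
rewrite nrm2D nrmZ nrm_real innerZr cRe_mulr exprMn.
by rewrite real_normK ?num_real // mulrnAr.
Qed.

Lemma nrm_ball x y (e : R) : ball x e%:C%C y = (nrm (x - y) < e).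
Proof. by rewrite -ball_normE /ball_ /= nrmC ltcR. Qed.

Lemma nrm_complete (u : nat -> H) :
  (forall e : R, 0 < e -> exists N, forall m n, (N <= m)%N -> (N <= n)%N ->
     nrm (u m - u n) < e) ->
  exists l, forall e : R, 0 < e -> exists N, forall n, (N <= n)%N ->
     nrm (u n - l) < e.
Proof.
move=> hu.
have : cauchy (u @ \oo).
  apply: cauchy_exP => e e0.
  have eE : e = (complex.Re e)%:C%C by rewrite RRe_real // gtr0_real.
  have [N hN] : exists N, forall m n, (N <= m)%N -> (N <= n)%N ->
     nrm (u m - u n) < complex.Re e by apply: hu; rewrite -ltcR -eE.
  exists (u N), N => // n /= Nn; rewrite eE nrm_ball; exact: hN.
move/cauchy_cvgP => /cvg_ex[l ul]; exists l => e e0.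
have /ul : nbhs l (ball l e%:C%C).
  by apply: nbhsx_ballx; rewrite ltcR.
case=> N _ hN; exists N => n Nn; rewrite nrm_distC -nrm_ball; exact: hN.
Qed.

Lemma denseP (D : set H) : dense D ->
  forall x (e : R), 0 < e -> exists2 y, D y & nrm (x - y) < e.
Proof.
move=> dD x e e0.
have [] := dD (ball x e%:C%C).
- by exists x; apply: ballxx; rewrite ltcR.
- by apply: ball_open; rewrite ltcR.
move=> y [xy Dy]; exists y => //; by rewrite -nrm_ball.
Qed.

Lemma closureP (D : set H) x : closure D x ->
  forall (e : R), 0 < e -> exists2 y, D y & nrm (x - y) < e.
Proof.
move=> cx e e0; have [|y [Dy xy]] := cx (ball x e%:C%C).
  by apply: nbhsx_ballx; rewrite ltcR.
by exists y => //; rewrite -nrm_ball.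
Qed.

End HilbertBasics.
(** * Variational form of the Riesz representation theorem *)
Section Riesz.
Context {R : realType} {H : hilbertType R}.
Local Notation C := R[i].

Section LinearOn.
Variables (V : lmodType C) (D : set H) (f : H -> V).
Hypothesis lin : linear_on D f.

Lemma linear_on_dom0 : D 0. Proof. by case: lin. Qed.

Lemma linear_onD x y : D x -> D y -> D (x + y) /\ f (x + y) = f x + f y.
Proof. by move=> Dx Dy; have := lin.2 1 x y Dx Dy; rewrite !scale1r. Qed.

Lemma linear_on0 : f 0 = 0.
Proof.
have [_ /eqP] := linear_onD linear_on_dom0 linear_on_dom0.
by rewrite addr0 -subr_eq subrr eq_sym => /eqP.
Qed.

Lemma linear_onZ (a : C) x : D x -> D (a *: x) /\ f (a *: x) = a *: f x.
Proof.
by move=> Dx; have := lin.2 a x 0 Dx linear_on_dom0; rewrite linear_on0 !addr0.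
Qed.

Lemma linear_onN x : D x -> D (- x) /\ f (- x) = - f x.
Proof. by move=> /(linear_onZ (-1)); rewrite !scaleN1r. Qed.

Lemma linear_onB x y : D x -> D y -> D (x - y) /\ f (x - y) = f x - f y.
Proof.
move=> Dx Dy; have [DNy fNy] := linear_onN Dy.
by have := linear_onD Dx DNy; rewrite fNy.
Qed.

End LinearOn.

(** First-order condition at a minimum: t = - g / (S + 1) makes the right-hand
    side negative unless g = 0. *)
Lemma quadratic_ge0_eq0 (g S : R) : 0 <= S ->
  (forall t : R, 0 <= t * g *+ 2 + t ^+ 2 * S) -> g = 0.
Proof.
move=> S0 /(_ (- g / (S + 1))) h.
have S1 : 0 < S + 1 by lra.
have E : (S + 1) ^+ 2 * (- g / (S + 1) * g *+ 2 + (- g / (S + 1)) ^+ 2 * S)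
    = - (g ^+ 2 * (S + 2)) by field; lra.
have : 0 <= - (g ^+ 2 * (S + 2)) by rewrite -E mulr_ge0 ?sqr_ge0.
rewrite oppr_ge0 => h2; apply/eqP; rewrite -sqrf_eq0 eq_le sqr_ge0 andbT.
by rewrite -(pmulr_lle0 (x := S + 2)) //; lra.
Qed.

(** The functional J x = |T x|^2 - 2 Re (f x) is bounded below by - n^2. The
    parallelogram identity makes T x_k Cauchy along a minimizing sequence x_k,
    and the vanishing of the first variation of J identifies the limit y as the
    vector that represents f through T. Taking for T the identity gives the
    Riesz theorem, and taking a shifted self-adjoint operator gives
    surjectivity and weak solutions of the resolvent equation. *)
Lemma variational_riesz (D : set H) (T : H -> H) (f : H -> C) (n : R) :
  linear_on D T -> linear_on D (f : H -> C^o) -> 0 <= n ->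
  (forall x, D x -> nrm (f x) <= n * nrm (T x)) ->
  exists y, [/\ nrm y <= n, forall x, D x -> inner y (T x) = f x &
    forall e : R, 0 < e -> exists2 x, D x & nrm (y - T x) < e].
Proof.
move=> linT linf n0 bnd.
pose J x := nrm (T x) ^+ 2 - complex.Re (f x) *+ 2.
have J_ge x : D x -> - n ^+ 2 <= J x.
  move=> Dx; have := sqr_ge0 (nrm (T x) - n).
  have := le_trans (Re_le_nrm (f x)) (bnd x Dx).
  rewrite /J; lra.
have infJ : has_inf [set J x | x in D].
  split; first by exists (J 0); exists 0 => //; exact: linear_on_dom0 linT.
  by exists (- n ^+ 2) => _ [x Dx <-]; exact: J_ge.
pose m := inf [set J x | x in D].
have m_le x : D x -> m <= J x.
  by move=> Dx; apply: ge_inf; [exact: infJ.2 | exists x].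
(* J is quadratic along the line x + t y, which gives the first variation. *)
have JD (x y : H) (t : R) : D x -> D y -> D (x + t%:C%C *: y) /\
    J (x + t%:C%C *: y) =
      J x + t * (complex.Re (inner (T x) (T y)) - complex.Re (f y)) *+ 2
      + t ^+ 2 * nrm (T y) ^+ 2.
  move=> Dx Dy.
  have [Dty Tty] := linear_onZ linT t%:C%C Dy.
  have [_ fty] := linear_onZ linf t%:C%C Dy.
  have [Ds Ts] := linear_onD linT Dx Dty.
  have [_ fs] := linear_onD linf Dx Dty.
  split=> //; rewrite /J Ts Tty nrm_lincomb fs fty cRe_add.
  have -> : complex.Re (t%:C%C *: f y : C^o) = t * complex.Re (f y).
    exact: cRe_mulr.
  ring.
(* m <= J ((x + y) / 2), rewritten with the parallelogram identity. *)
have close x y : D x -> D y ->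
    nrm (T x - T y) ^+ 2 <= (J x - m) *+ 2 + (J y - m) *+ 2.
  move=> Dx Dy.
  have [Dd Td] := linear_onB linT Dy Dx.
  have [_ fd] := linear_onB linf Dy Dx.
  have [Dm Jm] := JD x (y - x) 2^-1 Dx Dd.
  have := m_le _ Dm; rewrite Jm Td fd.
  rewrite innerDr innerNr !cRe_add !cRe_opp -nrm2E.
  rewrite (nrm_distC (T x)) nrm2D nrmN innerNr cRe_opp (Re_innerC (T y) (T x)) /J.
  lra.
have approx (e : R) : 0 < e -> exists2 x, D x & J x < m + e.
  move=> e0; have [_ [x Dx <-] h] := inf_adherent e0 infJ; by exists x.
have [u uP] : {u : nat -> H & forall k, D (u k) /\ J (u k) < m + k.+1%:R^-1}.
  apply: (choice (P := fun k x => D x /\ J x < m + k.+1%:R^-1)) => k.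
  have [|x Dx h] := approx k.+1%:R^-1; first by rewrite invr_gt0.
  by exists x.
have invS N k : (N <= k)%N -> k.+1%:R^-1 <= N.+1%:R^-1 :> R.
  by move=> h; rewrite lef_pV2 ?posrE // ler_nat ltnS.
have [y yP] : exists l, forall e : R, 0 < e -> exists N, forall k, (N <= k)%N ->
     nrm (T (u k) - l) < e.
  apply: nrm_complete => e e0.
  have [N hN] : exists N, 0 + N.+1%:R^-1 < e ^+ 2 / 4.
    by apply: ltr_add_invr; rewrite divr_gt0 ?exprn_gt0.
  exists N => k l Nk Nl.
  have h : nrm (T (u k) - T (u l)) ^+ 2 < e ^+ 2.
    apply: le_lt_trans (close _ _ (uP k).1 (uP l).1) _.
    move: hN (uP k).2 (uP l).2 (invS _ _ Nk) (invS _ _ Nl); rewrite add0r.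
    move: (N.+1%:R^-1 : R) (k.+1%:R^-1 : R) (l.+1%:R^-1 : R) (J _) (J _).
    move=> a b c ? ?; lra.
  by rewrite -(ltr_pXn2r (ltn0Sn 1)) ?nnegrE ?nrm_ge0 ?ltW.
have near_y (e : R) : 0 < e -> exists k, J (u k) < m + e /\ nrm (T (u k) - y) < e.
  move=> e0; have [N1 h1] := yP e e0.
  have [N2] := ltr_add_invr e0; rewrite add0r => h2.
  exists (maxn N1 N2); split; last by apply: h1; rewrite leq_maxl.
  apply: lt_trans (uP _).2 _; rewrite ltrD2l.
  by apply: le_lt_trans h2; apply: invS; rewrite leq_maxr.
have ReE x : D x -> complex.Re (inner y (T x)) = complex.Re (f x).
  move=> Dx; apply/eqP; rewrite -subr_eq0; apply/eqP.
  apply: (quadratic_ge0_eq0 (sqr_ge0 (nrm (T x)))) => t.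
  apply/ler_addgt0Pr => e e0.
  pose K := 1 + `|t| * nrm (T x) *+ 2.
  have K0 : 0 < K.
    by rewrite ltr_pwDl // mulrn_wge0 // mulr_ge0 ?nrm_ge0.
  have [k [Jk yk]] := near_y (e / K) (divr_gt0 e0 K0).
  have [Dm Jm] := JD (u k) x t (uP k).1 Dx.
  have := m_le _ Dm; rewrite Jm.
  have -> : inner (T (u k)) (T x) = inner y (T x) + inner (T (u k) - y) (T x).
    by rewrite -innerDl addrC subrK.
  rewrite cRe_add => h.
  have h1 : t * complex.Re (inner (T (u k) - y) (T x)) <= `|t| * (e / K * nrm (T x)).
    apply: le_trans (ler_norm _) _; rewrite normrM ler_wpM2l //.
    rewrite ler_norml; apply/andP; split.
      rewrite -[X in _ <= X]opprK lerN2 -cRe_opp -innerNl.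
      apply: le_trans (Re_inner_le _ _) _.
      by rewrite ler_wpM2r ?nrm_ge0 // nrmN ltW.
    apply: le_trans (Re_inner_le _ _) _.
    by rewrite ler_wpM2r ?nrm_ge0 // ltW.
  have h2 : e = e / K + `|t| * (e / K * nrm (T x)) *+ 2.
    by rewrite -[LHS](divfK (lt0r_neq0 K0)) {2}/K; ring.
  lra.
have yE x : D x -> inner y (T x) = f x.
  move=> Dx; apply: complex_eqP; first exact: ReE.
  have [Dix Tix] := linear_onZ linT 'i Dx.
  have [_ fix_] := linear_onZ linf 'i Dx.
  have := ReE _ Dix; rewrite Tix innerZr fix_ cRe_muli.
  have -> : complex.Re ('i *: f x : C^o) = - complex.Im (f x) by exact: cRe_muli.
  by move/oppr_inj.
have yapp (e : R) : 0 < e -> exists2 x, D x & nrm (y - T x) < e.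
  move=> /near_y[k [_ h]]; exists (u k); [exact: (uP k).1 | by rewrite nrm_distC].
exists y; split => //.
(* |y|^2 = lim <y, T u_k> = lim f (u_k) <= n |y|. *)
have [->|y0] := eqVneq y 0; first by rewrite nrm0.
have ny : 0 < nrm y by rewrite lt_def nrm_eq0 y0 nrm_ge0.
apply/ler_addgt0Pr => e e0.
pose d := e * nrm y / (n + nrm y).
have s0 : 0 < n + nrm y by rewrite ltr_wpDl.
have d0 : 0 < d by rewrite divr_gt0 // mulr_gt0.
have [x Dx yx] := yapp d d0.
have h1 : nrm (T x) <= nrm y + d.
  have := nrm_sub_ge (T x) y; rewrite nrm_distC; lra.
have h2 : nrm y ^+ 2 <= nrm y * d + n * (nrm y + d).
  rewrite nrm2E; have {2}-> : y = (y - T x) + T x by rewrite subrK.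
  rewrite innerDr cRe_add lerD //.
    apply: le_trans (Re_inner_le _ _) _; rewrite ler_wpM2l ?nrm_ge0 //; exact: ltW.
  rewrite yE //; apply: le_trans (Re_le_nrm _) _; apply: le_trans (bnd _ Dx) _.
  by rewrite ler_wpM2l.
have h3 : nrm y * d + n * (nrm y + d) = nrm y * (n + e).
  by rewrite /d; field; lra.
by move: h2; rewrite h3 expr2 ler_pM2l.
Qed.

Lemma riesz (f : H -> C) (M : R) : 0 <= M ->
  (forall (a : C) x y, f (a *: x + y) = a * f x + f y) ->
  (forall x, nrm (f x) <= M * nrm x) -> exists u, forall x, inner u x = f x.
Proof.
move=> M0 lf bf.
have [||||y [_ h _]] := @variational_riesz setT id f M.
- by split.
- by split => // a x y _ _; split => //; exact: lf.
- by [].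
- by move=> x _; exact: bf.
by exists y => x; apply: h.
Qed.

Lemma dense_orthogonal (D : set H) :
  (forall x (e : R), 0 < e -> exists2 y, D y & nrm (x - y) < e) ->
  forall v, (forall y, D y -> inner v y = 0) -> v = 0.
Proof.
move=> dD v vD; apply/eqP; rewrite -nrm_eq0 eq_le nrm_ge0 andbT.
apply/ler_addgt0Pr => e e0; rewrite add0r.
have [y Dy vy] := dD v e e0.
have [->|v0] := eqVneq v 0; first by rewrite nrm0 ltW.
have nv : 0 < nrm v by rewrite lt_def nrm_eq0 v0 nrm_ge0.
have : nrm v ^+ 2 <= nrm v * e.
  rewrite nrm2E; have -> : inner v v = inner v (v - y).
    by rewrite innerDr innerNr (vD y) // oppr0 addr0.
  apply: le_trans (Re_inner_le _ _) _; rewrite ler_wpM2l ?nrm_ge0 //; exact: ltW.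
by rewrite expr2 ler_pM2l.
Qed.

End Riesz.
(** * Self-adjoint operators, resolvents and the Cayley transform *)
Section SelfAdjoint.
Context {R : realType} {H : hilbertType R}.
Local Notation C := R[i].
Implicit Types (x y v : H) (z w : C).

Lemma adjointP (T : @operator R H) y (z : H) :
  (forall v, (forall x, dom T x -> inner v x = 0) -> v = 0) ->
  adjoint_val T y z -> adjoint T y = z.
Proof.
move=> orth yz; have := xgetPex 0 (ex_intro _ z yz : exists z : H, adjoint_val T y z).
rewrite -[xget _ _]/(adjoint T y) => h.
apply/eqP; rewrite -subr_eq0; apply/eqP/orth => x Dx.
by rewrite !innerE -(h x Dx) -(yz x Dx) subrr.
Qed.

Variable A : @operator R H.
Hypothesis A_sa : self_adjoint A.

Let linA : linear_on (dom A) A. Proof. by case: A_sa. Qed.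

Lemma sa_dense x (e : R) : 0 < e -> exists2 y, dom A y & nrm (x - y) < e.
Proof. by case: A_sa => _ /denseP + _; exact. Qed.

Lemma sa_orth v : (forall y, dom A y -> inner v y = 0) -> v = 0.
Proof. exact: dense_orthogonal sa_dense v. Qed.

Lemma sa_sym x y : dom A x -> dom A y -> inner x (A y) = inner (A x) y.
Proof.
case: A_sa => _ _ [domE valE] Dx Dy.
have : dom (adjoint A) x by rewrite domE.
case=> z xz; have E := valE x Dx.
by rewrite -E (adjointP sa_orth xz); exact: xz.
Qed.

Lemma sa_max y (z : H) : (forall x, dom A x -> inner y (A x) = inner z x) ->
  dom A y /\ A y = z.
Proof.
move=> yz; case: A_sa => _ _ [domE valE].
have Dy : dom A y by rewrite -domE; exists z.
by split => //; rewrite -valE // (adjointP sa_orth yz).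
Qed.

Lemma shiftD z x y : dom A x -> dom A y ->
  A (x + y) - z *: (x + y) = (A x - z *: x) + (A y - z *: y).
Proof.
by move=> Dx Dy; rewrite (linear_onD linA Dx Dy).2 scalerDr opprD addrACA.
Qed.

Lemma shiftZ z (a : C) x : dom A x -> A (a *: x) - z *: (a *: x) = a *: (A x - z *: x).
Proof.
by move=> Dx; rewrite (linear_onZ linA a Dx).2 scalerBr !scalerA mulrC.
Qed.

Lemma shiftB z x y : dom A x -> dom A y ->
  A (x - y) - z *: (x - y) = (A x - z *: x) - (A y - z *: y).
Proof.
move=> Dx Dy; rewrite (linear_onB linA Dx Dy).2; apply: inner_extr => u.
by rewrite !innerE; ring.
Qed.

Lemma shift_linear_on z : linear_on (dom A) (fun x => A x - z *: x).
Proof.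
split; first exact: linear_on_dom0 linA.
move=> a x y Dx Dy; have [Dax _] := linear_onZ linA a Dx.
by split; [exact: (linA.2 a x y Dx Dy).1 | rewrite shiftD // shiftZ].
Qed.

Lemma shift_sym z x y : dom A x -> dom A y ->
  inner x (A y - z *: y) = inner (A x - z^* *: x) y.
Proof. by move=> Dx Dy; rewrite !innerE conjCK sa_sym. Qed.

(** Given v, the form x |-> <v, x> is bounded by |(A - z^* I)x|, hence is
    represented by some y as <y, (A - z^* I)x>; self-adjointness puts y in the
    domain and gives (A - z)y = v. No closed-range argument is involved. *)
Lemma shift_surj z (m : R) : 0 < m ->
  (forall x, dom A x -> m * nrm x <= nrm (A x - z^* *: x)) ->
  forall v, exists2 x, dom A x & A x - z *: x = v.
Proof.
move=> m0 bnd v.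
have [||||y [_ h _]] := @variational_riesz R H (dom A)
  (fun x => A x - z^* *: x) (inner v) (nrm v / m).
- exact: shift_linear_on.
- split; first exact: linear_on_dom0 linA.
  by move=> a x y Dx Dy; rewrite !innerE; split => //; exact: (linA.2 a x y Dx Dy).1.
- by rewrite divr_ge0 ?nrm_ge0 // ltW.
- move=> x Dx; apply: le_trans (inner_le_nrm _ _) _.
  rewrite -mulrA ler_wpM2l ?nrm_ge0 // ler_pdivlMl //; exact: bnd.
have [x Dx|Dy Ay] := @sa_max y (v + z *: y); last first.
  by exists y => //; rewrite Ay addrK.
by rewrite innerDl -(h x Dx) !innerE subrK.
Qed.

Lemma Im_inner_sa x : dom A x -> complex.Im (inner x (A x)) = 0.
Proof.
move=> Dx; have := congr1 (@complex.Im R) (innerC x (A x)).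
by rewrite -(sa_sym Dx Dx) cIm_conj; lra.
Qed.

(** <x, A x> is real, so the real and imaginary parts of the shift contribute
    orthogonally. *)
Lemma nrm_shift z x : dom A x ->
  nrm (A x - z *: x) ^+ 2 =
  nrm (A x - (complex.Re z)%:C%C *: x) ^+ 2 + complex.Im z ^+ 2 * nrm x ^+ 2.
Proof.
move=> Dx; have Ix := Im_inner_sa Dx.
have -> : A x - z *: x = (A x - (complex.Re z)%:C%C *: x)
    + (- complex.Im z)%:C%C *: ('i *: x).
  apply: inner_extr => u; rewrite !innerE {1}(complexE z) complexiE rmorphN /=.
  ring.
rewrite nrm_lincomb nrmZ nrm_i mul1r sqrrN !innerE conj_real.
rewrite -(sa_sym Dx Dx) cRe_add cRe_opp !cRe_muli Ix innerxxE /=.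
by ring.
Qed.

Lemma shift_ge_Im z x : dom A x -> `|complex.Im z| * nrm x <= nrm (A x - z *: x).
Proof.
move=> Dx; rewrite -(ler_pXn2r (ltn0Sn 1)) ?nnegrE ?nrm_ge0 ?mulr_ge0 //.
  by rewrite nrm_shift // exprMn real_normK ?num_real // lerDr sqr_ge0.
exact: nrm_ge0.
Qed.

Lemma shift_ge_Re z x : dom A x ->
  nrm (A x - (complex.Re z)%:C%C *: x) <= nrm (A x - z *: x).
Proof.
move=> Dx; rewrite -(ler_pXn2r (ltn0Sn 1)) ?nnegrE ?nrm_ge0 //.
by rewrite [leRHS]nrm_shift // lerDl mulr_ge0 ?sqr_ge0.
Qed.

Lemma shift_inj z x y : complex.Im z != 0 -> dom A x -> dom A y ->
  A x - z *: x = A y - z *: y -> x = y.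
Proof.
move=> z0 Dx Dy xy; have [Dxy _] := linear_onB linA Dx Dy.
have := shift_ge_Im z Dxy; rewrite shiftB // xy subrr nrm0.
rewrite pmulr_rle0 ?normr_gt0 // => h; apply/eqP.
by rewrite -subr_eq0 -nrm_eq0 eq_le h nrm_ge0.
Qed.

Local Notation Rs := (resolvent A).

Lemma resolventP z v : complex.Im z != 0 -> dom A (Rs z v) /\ A (Rs z v) - z *: Rs z v = v.
Proof.
move=> z0; have [||x Dx xv] := @shift_surj z `|complex.Im z| _ _ v.
- by rewrite normr_gt0.
- by move=> x Dx; have := shift_ge_Im z^* Dx; rewrite cIm_conj normrN.
exact: (xgetPex 0 (ex_intro _ x (conj Dx xv) : exists x, resolvent_eq A z v x)).
Qed.

Lemma resolvent_dom z v : complex.Im z != 0 -> dom A (Rs z v).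
Proof. by move=> z0; case: (resolventP v z0). Qed.

Lemma resolventK z v : complex.Im z != 0 -> A (Rs z v) = v + z *: Rs z v.
Proof. by move=> z0; case: (resolventP v z0) => _ {2}<-; rewrite subrK. Qed.

Lemma resolvent_eqP z v x : complex.Im z != 0 -> dom A x -> A x - z *: x = v -> Rs z v = x.
Proof.
move=> z0 Dx xv; have [D' E'] := resolventP v z0.
by apply: (shift_inj z0 D' Dx); rewrite E'.
Qed.

Lemma resolvent_lin z (a : C) x y : complex.Im z != 0 ->
  Rs z (a *: x + y) = a *: Rs z x + Rs z y.
Proof.
move=> z0; have [Dx Ex] := resolventP x z0; have [Dy Ey] := resolventP y z0.
have [Dax _] := linear_onZ linA a Dx.
apply: resolvent_eqP => //; first by case: (linear_onD linA Dax Dy).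
by rewrite shiftD // shiftZ // Ex Ey.
Qed.

Lemma resolvent_le z x : complex.Im z != 0 -> nrm (Rs z x) <= nrm x / `|complex.Im z|.
Proof.
move=> z0; have [Dx Ex] := resolventP x z0.
by rewrite ler_pdivlMr ?normr_gt0 // mulrC -{2}Ex; exact: shift_ge_Im.
Qed.

Lemma resolvent_adj z x y : complex.Im z != 0 ->
  inner (Rs z x) y = inner x (Rs z^* y).
Proof.
move=> z0; have z0' : complex.Im z^* != 0 by rewrite cIm_conj oppr_eq0.
have [Dx Ex] := resolventP x z0; have [Dy Ey] := resolventP y z0'.
by rewrite -{1}Ey shift_sym // conjCK Ex.
Qed.

(** Rs z (Rs w x) lies in the domain of the square of A, where the two shifts
    commute. *)
Lemma resolvent_comm z w x : complex.Im z != 0 -> complex.Im w != 0 ->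
  Rs z (Rs w x) = Rs w (Rs z x).
Proof.
move=> z0 w0.
have [Dw Ew] := resolventP x w0.
have [Dzw Ezw] := resolventP (Rs w x) z0.
have DA : dom A (A (Rs z (Rs w x))).
  by rewrite resolventK //; apply: (linear_onD linA _ (linear_onZ linA z Dzw).1).1.
have [D1 E1] := linear_onB linA DA (linear_onZ linA w Dzw).1.
symmetry; apply: resolvent_eqP => //.
symmetry; apply: resolvent_eqP => //.
have AA : A (A (Rs z (Rs w x))) = A (Rs w x) + z *: A (Rs z (Rs w x)).
  rewrite {1}resolventK //.
  have [Dz Az] := linear_onZ linA z Dzw.
  by rewrite (linear_onD linA Dw Dz).2 Az.
rewrite E1 (linear_onZ linA w Dzw).2 AA (resolventK x w0) (resolventK (Rs w x) z0).
by apply: inner_extr => u; rewrite !innerE; ring.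
Qed.

(** (A + i)(A - i)^-1, written as 1 + 2i (A - i)^-1 so that it is visibly
    everywhere defined; likewise (A - i)(A + i)^-1 below. *)
Definition cayley x := x + (2 * 'i) *: Rs 'i x.
Definition cayley_inv x := x - (2 * 'i) *: Rs (- 'i) x.

Lemma cIm_i_neq0 : complex.Im ('i : C) != 0.
Proof. by rewrite -complexiE /= oner_eq0. Qed.
Lemma cIm_Ni_neq0 : complex.Im (- 'i : C) != 0.
Proof. by rewrite -complexiE /= oppr_eq0 oner_eq0. Qed.

Lemma cayleyE x : cayley x = A (Rs 'i x) + 'i *: Rs 'i x.
Proof.
by rewrite /cayley (resolventK x cIm_i_neq0); apply: inner_extr => u; rewrite !innerE; ring.
Qed.

Lemma cayley_invE x : cayley_inv x = A (Rs (- 'i) x) - 'i *: Rs (- 'i) x.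
Proof.
by rewrite /cayley_inv (resolventK x cIm_Ni_neq0); apply: inner_extr => u; rewrite !innerE; ring.
Qed.

Lemma cayley_lin (a : C) x y : cayley (a *: x + y) = a *: cayley x + cayley y.
Proof.
rewrite /cayley resolvent_lin ?cIm_i_neq0 //; apply: inner_extr => u.
by rewrite !innerE; ring.
Qed.

Lemma cayley_inv_lin (a : C) x y :
  cayley_inv (a *: x + y) = a *: cayley_inv x + cayley_inv y.
Proof.
rewrite /cayley_inv resolvent_lin ?cIm_Ni_neq0 //; apply: inner_extr => u.
by rewrite !innerE; ring.
Qed.

Lemma nrm_shift_conj z x : dom A x -> nrm (A x - z^* *: x) = nrm (A x - z *: x).
Proof.
move=> Dx; apply/eqP; rewrite -(eqrXn2 (n := 2)) ?nrm_ge0 //.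
by rewrite nrm_shift // [in eqbRHS]nrm_shift // cRe_conj cIm_conj sqrrN.
Qed.

Lemma nrm_cayley x : nrm (cayley x) = nrm x.
Proof.
have [Dx Ex] := resolventP x cIm_i_neq0.
rewrite cayleyE -{3}Ex -(nrm_shift_conj 'i Dx) conjCi scaleNr opprK //.
Qed.

Lemma nrm_cayley_inv x : nrm (cayley_inv x) = nrm x.
Proof.
have [Dx Ex] := resolventP x cIm_Ni_neq0.
by rewrite cayley_invE -{3}Ex -(nrm_shift_conj (- 'i) Dx) rmorphN /= conjCi opprK.
Qed.

Lemma cayley_adj x y : inner (cayley_inv x) y = inner x (cayley y).
Proof.
rewrite /cayley /cayley_inv !innerE (resolvent_adj _ _ cIm_Ni_neq0) rmorphN /= conjCi.
by rewrite opprK rmorphM /= conjCi rmorph_nat; ring.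
Qed.

Lemma cayley_comm z x : complex.Im z != 0 -> cayley (Rs z x) = Rs z (cayley x).
Proof.
move=> z0; rewrite /cayley [in RHS]addrC resolvent_lin // [RHS]addrC.
by rewrite resolvent_comm // cIm_i_neq0.
Qed.

End SelfAdjoint.
(** * Discrete Fourier analysis of a unitary operator *)
Section RootsOfUnity.
Context {R : realType}.
Local Notation C := R[i].

(** A 2^m-th root of -1 has order exactly 2^(m+1). *)
Lemma prim_root2X_exists m : exists z : C, (2 ^ m.+1).-primitive_root z.
Proof.
have N0 : (0 < 2 ^ m)%N by rewrite expn_gt0.
pose z : C := (2 ^ m)%N.-root (-1).
have zm : z ^+ (2 ^ m) = -1 by rewrite rootCK.
have zN : z ^+ (2 ^ m.+1) = 1 by rewrite expnSr exprM zm sqrrN expr1n.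
have [|k kz kN] := prim_order_exists _ zN; first by rewrite expn_gt0.
have /(dvdn_pfactor _ _ (isT : prime 2))[e em kE] := kN.
exists z; move: em kz; rewrite kE leq_eqVlt => /orP[/eqP->//|em kz].
have /eqP : z ^+ (2 ^ m) = 1.
  apply/eqP; rewrite -(prim_order_dvd kz).
  by rewrite dvdn_exp2l.
by rewrite zm -subr_eq0 -opprD oppr_eq0 (_ : 1 + 1 = 2%:R) // pnatr_eq0.
Qed.

Lemma nrm_prim_root N (z : C) : (0 < N)%N -> N.-primitive_root z -> nrm z = 1.
Proof.
move=> N0 /prim_expr_order zN; apply/eqP.
by rewrite -(@pexpr_eq1 _ _ N) ?nrm_ge0 -?lt0n // -nrmX zN nrm1.
Qed.

Lemma nrm1_conj (z : C) : nrm z = 1 -> z * z^* = 1.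
Proof. by move=> z1; rewrite -normCK nrmC z1 rmorph1 expr1n. Qed.

Lemma root_orthogonality N (z : C) (j l : 'I_N) : N.-primitive_root z ->
  \sum_(k < N) (z ^+ l * (z ^+ j)^*) ^+ k = if j == l then N%:R else 0.
Proof.
move=> zP.
have N0 : (0 < N)%N by case: (N) j => [[]|].
have nz := nrm_prim_root N0 zP.
have zz i : z ^+ i * (z ^+ i)^* = 1 by apply: nrm1_conj; rewrite nrmX nz expr1n.
case: eqVneq => [->|jl].
  under eq_bigr do rewrite zz expr1n.
  by rewrite sumr_const card_ord.
set x := z ^+ l * _.
have x1 : x != 1.
  apply: contra jl => /eqP x1.
  have /eqP : z ^+ l = z ^+ j.
    by rewrite -[LHS]mulr1 -(zz j) mulrCA -/x x1 mulr1.
  by rewrite (eq_prim_root_expr zP) !modn_small ?ltn_ord // eq_sym.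
have xN : x ^+ N = 1.
  rewrite exprMn -rmorphXn /= -!exprM !(mulnC _ N) !exprM (prim_expr_order zP).
  by rewrite !expr1n rmorph1 mulr1.
have /esym/eqP := subrX1 x N.
by rewrite xN subrr mulf_eq0 subr_eq0 (negPf x1) => /eqP.
Qed.

End RootsOfUnity.

Section Fourier.
Context {R : realType} {H : hilbertType R}.
Local Notation C := R[i].
Implicit Types (x y : H) (a z w : C).

Lemma inner_sumr (I : finType) (F : I -> H) x :
  inner x (\sum_i F i) = \sum_i inner x (F i).
Proof. by elim/big_rec2: _ => [|i y z _ <-]; rewrite ?inner0r ?innerDr. Qed.

Lemma inner_suml (I : finType) (F : I -> H) x :
  inner (\sum_i F i) x = \sum_i inner (F i) x.
Proof. by elim/big_rec2: _ => [|i y z _ <-]; rewrite ?inner0l ?innerDl. Qed.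

(** Summing over k first leaves only the diagonal terms, by orthogonality of
    the characters of Z/N. *)
Lemma discrete_parseval N z (v : 'I_N -> H) : N.-primitive_root z ->
  \sum_(k < N) nrm (\sum_(j < N) z ^+ k ^+ j *: v j) ^+ 2 =
  N%:R * \sum_(j < N) nrm (v j) ^+ 2.
Proof.
move=> zP; apply: complexI; rewrite rmorphM rmorph_nat !rmorph_sum /=.
have expand k : (nrm (\sum_(j < N) z ^+ k ^+ j *: v j) ^+ 2)%:C%C =
    \sum_(j < N) \sum_(l < N) inner (z ^+ k ^+ j *: v j) (z ^+ k ^+ l *: v l).
  by rewrite -innerxxE inner_suml; apply: eq_bigr => j _; rewrite inner_sumr.
under eq_bigr do rewrite expand.
rewrite exchange_big /= mulr_sumr; apply: eq_bigr => j _.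
rewrite exchange_big /= (bigD1 j) //= [X in _ + X]big1 ?addr0 => [|l lj].
  rewrite -innerxxE.
  under eq_bigr => k _.
    rewrite innerZl innerZr mulrA.
    have -> : (z ^+ k ^+ j)^* * z ^+ k ^+ j = (z ^+ j * (z ^+ j)^*) ^+ k.
      by rewrite -!exprM mulnC exprMn -rmorphXn /= -exprM mulrC.
    over.
  by rewrite -mulr_suml root_orthogonality // eqxx.
under eq_bigr => k _.
  rewrite innerZl innerZr mulrA.
  have -> : (z ^+ k ^+ j)^* * z ^+ k ^+ l = (z ^+ l * (z ^+ j)^*) ^+ k.
    by rewrite -!exprM !(mulnC k) exprMn -rmorphXn /= -!exprM mulrC.
  over.
by rewrite -mulr_suml root_orthogonality // eq_sym (negPf lj) mul0r.
Qed.

(** Dirichlet kernel of W: when W is unitary and |a| = 1, pow_sum W a n / n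
    concentrates near the spectral value a^* of W. *)
Definition pow_sum (W : H -> H) a n x := \sum_(j < n) a ^+ j *: iter j W x.

Section PowSum.
Variable W : H -> H.
Hypothesis W_lin : forall a x y, W (a *: x + y) = a *: W x + W y.
Hypothesis W_iso : forall x, nrm (W x) = nrm x.

Lemma isometry0 : W 0 = 0.
Proof. by apply/eqP; rewrite -nrm_eq0 W_iso nrm0. Qed.
Lemma isometryD x y : W (x + y) = W x + W y.
Proof. by have := W_lin 1 x y; rewrite !scale1r. Qed.
Lemma isometryZ a x : W (a *: x) = a *: W x.
Proof. by have := W_lin a x 0; rewrite isometry0 !addr0. Qed.

Lemma nrm_iter j x : nrm (iter j W x) = nrm x.
Proof. by elim: j => //= j IH; rewrite W_iso. Qed.

Lemma iter_lin j a x y : iter j W (a *: x + y) = a *: iter j W x + iter j W y.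
Proof. by elim: j => //= j ->; rewrite W_lin. Qed.

Lemma pow_sumS a n x : pow_sum W a n.+1 x = pow_sum W a n x + a ^+ n *: iter n W x.
Proof. by rewrite /pow_sum big_ord_recr. Qed.

Lemma pow_sum_lin a n b x y :
  pow_sum W a n (b *: x + y) = b *: pow_sum W a n x + pow_sum W a n y.
Proof.
elim: n => [|n IH]; first by rewrite /pow_sum !big_ord0 scaler0 addr0.
rewrite !pow_sumS IH iter_lin !scalerDr !scalerA (mulrC b) addrACA.
by rewrite -!addrA.
Qed.

Lemma pow_sum_comm a n x : W (pow_sum W a n x) = pow_sum W a n (W x).
Proof.
elim: n => [|n IH]; first by rewrite /pow_sum !big_ord0 isometry0.
by rewrite !pow_sumS isometryD IH isometryZ -iterSr.
Qed.

Lemma pow_sum_telescope a n x :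
  a *: W (pow_sum W a n x) - pow_sum W a n x = a ^+ n *: iter n W x - x.
Proof.
elim: n => [|n IH].
  by rewrite /pow_sum !big_ord0 isometry0 scaler0 subr0 expr0 scale1r subrr.
rewrite pow_sumS isometryD isometryZ scalerDr scalerA -exprS opprD addrACA IH /=.
by rewrite addrC addrA subrK.
Qed.

(** The geometric sum telescopes under a W - 1, so that it is an approximate
    eigenvector of W for a^*, with an error independent of n. *)
Lemma pow_sum_near a n x : nrm a = 1 ->
  nrm (W (pow_sum W a n x) - a^* *: pow_sum W a n x) <= 2 * nrm x.
Proof.
move=> a1.
have <- : nrm (a *: W (pow_sum W a n x) - pow_sum W a n x)
        = nrm (W (pow_sum W a n x) - a^* *: pow_sum W a n x).
  rewrite -[RHS]mul1r -a1 -nrmZ scalerBr scalerA nrm1_conj //.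
  by rewrite scale1r.
rewrite pow_sum_telescope; apply: le_trans (nrmD _ _) _.
by rewrite nrmN nrmZ nrmX a1 expr1n mul1r nrm_iter; lra.
Qed.

End PowSum.

Lemma pow_sum_adj (U V : H -> H) a n x y :
  (forall x y, inner (U x) y = inner x (V y)) ->
  inner (pow_sum U a n x) y = inner x (pow_sum V a^* n y).
Proof.
move=> adj; rewrite inner_suml inner_sumr; apply: eq_bigr => j _.
rewrite innerZl innerZr rmorphXn; congr (_ * _).
elim: (nat_of_ord j) x y => //= k IH u v.
by rewrite adj IH -iterSr.
Qed.

(** Used with P the defect in an inequality and Q a bound independent of the
    number 2^(m+1) of Fourier modes. *)
Lemma sq_le_of_linear_bound (P Q : R) :
  (forall m, (2 ^ m.+1)%:R * P <= Q) -> P <= 0.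
Proof.
move=> h; rewrite leNgt; apply/negP => P0.
have [m Qm] : exists m : nat, Q / P < m%:R.
  by exists (Num.trunc (Q / P)).+1; exact: truncnS_gt.
have := h m; apply/negP; rewrite -ltNge -ltr_pdivrMr //.
apply: lt_le_trans Qm _; rewrite ler_nat.
by apply: ltnW; apply: leq_trans (ltn_expl _ (ltnSn 1)) _; rewrite leq_exp2l.
Qed.

(** A substitute for the spectral projection of U onto an arc. Let S_k be the
    Dirichlet kernels of U at the N-th roots of unity z^k. By Parseval,
    N^2 |x|^2 is the sum of |S_k x|^2 over k. If z^k lies in the arc of
    radius rho around w0, the local hypothesis, tested on the adjoint of S_k
    applied to S_k x, bounds |S_k x| by 2 K, uniformly in N. If z^k lies outside
    of the arc, then rho |S_k x| is at most |S_k d| + 2 |x| with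
    d = U x - w0^* x, and Parseval for d sums these terms. The arc thus
    contributes only O(N), and dividing by N^2 gives the estimate: x has no
    component over the arc, so it is not close to an eigenvector for w0^*. *)
Lemma unitary_local_bound (U V : H -> H) (w0 : C) (rho K : R) (x : H) :
  (forall a x y, U (a *: x + y) = a *: U x + U y) ->
  (forall a x y, V (a *: x + y) = a *: V x + V y) ->
  (forall x, nrm (U x) = nrm x) -> (forall x, nrm (V x) = nrm x) ->
  (forall x y, inner (U x) y = inner x (V y)) ->
  0 < rho -> 0 <= K ->
  (forall w, nrm w = 1 -> nrm (w - w0) < rho ->
     forall y, nrm (inner x y) <= K * nrm (V y - w *: y)) ->
  rho ^+ 2 * nrm x ^+ 2 <= 2 * nrm (U x - w0^* *: x) ^+ 2.
Proof.
move=> Ul Vl Ui Vi adj rho0 K0 loc.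
set d := U x - w0^* *: x.
rewrite -subr_le0.
apply: (@sq_le_of_linear_bound _ (4 * K ^+ 2 * rho ^+ 2 + 8 * nrm x ^+ 2)) => m.
have [z zP] := @prim_root2X_exists R m.
set N := (2 ^ m.+1)%N in zP *.
have N0 : (0 < N)%N by rewrite expn_gt0.
have nz k : nrm (z ^+ k) = 1 by rewrite nrmX (nrm_prim_root N0 zP) expr1n.
pose S k := pow_sum U (z ^+ k) N.
have parseval y : \sum_(k < N) nrm (S k y) ^+ 2 = N%:R ^+ 2 * nrm y ^+ 2.
  rewrite /S /pow_sum (@discrete_parseval N z (fun j => iter j U y) zP).
  have -> : \sum_(j < N) nrm (iter j U y) ^+ 2 = \sum_(j < N) nrm y ^+ 2.
    by apply: eq_bigr => j _; rewrite nrm_iter.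
  by rewrite sumr_const card_ord -(mulr_natl (nrm y ^+ 2)) mulrA -expr2.
have inarc k : nrm (z ^+ k - w0) < rho -> nrm (S k x) ^+ 2 <= 4 * K ^+ 2.
  move=> arc; set v := S k x.
  have h : nrm v ^+ 2 <= K * (2 * nrm v).
    rewrite nrm2E {1}/v /S (pow_sum_adj _ _ _ _ adj).
    apply: le_trans (Re_le_nrm _) _; apply: le_trans (loc _ (nz k) arc _) _.
    rewrite ler_wpM2l //.
    have := pow_sum_near (W := V) Vl Vi N v (a := (z ^+ k)^* ).
    by rewrite conjCK nrm_conj => ->.
  have [v0|v0] := eqVneq (nrm v) 0.
    by rewrite v0 expr0n /= mulr_ge0 ?sqr_ge0.
  have nv : 0 < nrm v by rewrite lt_def v0 nrm_ge0.
  have {}h : nrm v <= 2 * K.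
    by rewrite -(ler_pM2r nv) -expr2; apply: le_trans h _; rewrite mulrCA mulrA.
  have -> : 4 * K ^+ 2 = (2 * K) ^+ 2 by ring.
  by rewrite ler_pXn2r // ?nnegrE ?nrm_ge0 // mulr_ge0.
have offarc k : rho <= nrm (z ^+ k - w0) ->
    rho ^+ 2 * nrm (S k x) ^+ 2 <= 2 * nrm (S k d) ^+ 2 + 8 * nrm x ^+ 2.
  move=> off; set v := S k x.
  have Sd : S k d = U v - w0^* *: v.
    rewrite /d addrC -scaleNr /S pow_sum_lin // -(pow_sum_comm Ul Ui).
    by rewrite addrC scaleNr.
  have h1 : rho * nrm v <= nrm (S k d) + 2 * nrm x.
    apply: (@le_trans _ _ (nrm (z ^+ k - w0)^* * nrm v)).
      by rewrite nrm_conj ler_wpM2r ?nrm_ge0.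
    rewrite -nrmZ.
    have -> : (z ^+ k - w0)^* *: v = S k d - (U v - (z ^+ k)^* *: v).
      rewrite Sd rmorphB /=; apply: inner_extr => u; rewrite !innerE; ring.
    apply: le_trans (nrmD _ _) _; rewrite nrmN lerD2l.
    exact: pow_sum_near.
  have h2 : (rho * nrm v) ^+ 2 <= (nrm (S k d) + 2 * nrm x) ^+ 2.
    have rn : 0 <= rho * nrm v by rewrite mulr_ge0 ?nrm_ge0 ?ltW.
    by rewrite ler_pXn2r // nnegrE //; apply: le_trans h1.
  rewrite -exprMn; apply: le_trans h2 _.
  by have := sqr_ge0 (nrm (S k d) - 2 * nrm x); lra.
set Q := 4 * K ^+ 2 * rho ^+ 2 + _.
have each k : rho ^+ 2 * nrm (S k x) ^+ 2 <= Q + 2 * nrm (S k d) ^+ 2.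
  have h1 := sqr_ge0 (nrm (S k d)).
  have h2 := sqr_ge0 (nrm x).
  have h3 : 0 <= 4 * K ^+ 2 * rho ^+ 2 by rewrite mulr_ge0 ?sqr_ge0 // mulr_ge0 ?sqr_ge0 //.
  rewrite /Q; case: (ltP (nrm (z ^+ k - w0)) rho) => arc.
    have := ler_wpM2l (sqr_ge0 rho) (inarc k arc); lra.
  have := offarc k arc; lra.
have : \sum_(k < N) rho ^+ 2 * nrm (S k x) ^+ 2 <= \sum_(k < N) (Q + 2 * nrm (S k d) ^+ 2).
  by apply: ler_sum => k _; exact: each.
rewrite -mulr_sumr parseval big_split /= -mulr_sumr parseval sumr_const card_ord.
rewrite -(mulr_natl Q) => h.
have Npos : 0 < N%:R :> R by rewrite ltr0n.
rewrite -(ler_pM2l Npos).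
lra.
Qed.

End Fourier.
(** * Regular points and a local criterion for regularity *)
Section LocalRegularity.
Context {R : realType} {H : hilbertType R}.
Local Notation C := R[i].
Variable A : @operator R H.
Hypothesis A_sa : self_adjoint A.
Let linA : linear_on (dom A) A. Proof. by case: A_sa. Qed.
Implicit Types (x y : H) (z w : C) (s t : R).

(** For real s this is membership in the resolvent set, in the form that the
    estimates use; the lemmas spectrumP and spectrum_real below make the link. *)
Definition regular s := exists2 m : R, 0 < m &
  forall x, dom A x -> m * nrm x <= nrm (A x - s%:C%C *: x).

Lemma nrm_shift_move s t x :
  nrm (A x - t%:C%C *: x) <= nrm (A x - s%:C%C *: x) + `|s - t| * nrm x.
Proof.
have -> : A x - t%:C%C *: x = (A x - s%:C%C *: x) + (s - t)%:C%C *: x.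
  by rewrite rmorphB /= scalerBl addrA subrK.
by apply: le_trans (nrmD _ _) _; rewrite nrmZ nrm_real.
Qed.

Lemma regular_surj s : regular s -> forall v, exists2 x, dom A x & A x - s%:C%C *: x = v.
Proof.
case=> m m0 bnd; apply: (shift_surj A_sa m0) => x Dx.
by rewrite conj_real; exact: bnd.
Qed.

(** The quadratic form q = |(A - s)x|^2 - K^2 |x|^2 factors as
    <(A - s - K)x, (A - s + K)x>. When both factors are invertible, testing
    q >= 0 on x + t y, where (A - s + K)y = (A - s - K)x, bounds
    |(A - s - K)x|^2 by a multiple of q(x), so q is coercive. *)
Lemma regular_pair_gap s (K : R) : 0 <= K ->
  (forall x, dom A x -> K * nrm x <= nrm (A x - s%:C%C *: x)) ->
  regular (s + K) -> regular (s - K) ->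
  exists2 c : R, 0 < c & forall x, dom A x ->
    (K ^+ 2 + c) * nrm x ^+ 2 <= nrm (A x - s%:C%C *: x) ^+ 2.
Proof.
move=> K0 Kbnd [m1 m10 h1] reg2; have [m2 m20 h2] := reg2.
pose B x := A x - s%:C%C *: x.
have q_ge0 x : dom A x -> 0 <= nrm (B x) ^+ 2 - K ^+ 2 * nrm x ^+ 2.
  move=> Dx; rewrite subr_ge0 -exprMn ler_pXn2r ?nnegrE ?nrm_ge0 ?mulr_ge0 ?nrm_ge0 //.
  exact: Kbnd.
pose c2 := (1 + K / m2) ^+ 2.
have c20 : 0 < c2 by rewrite exprn_gt0 // ltr_pwDl // divr_ge0 // ltW.
exists (m1 ^+ 2 / c2) => [|x Dx]; first by rewrite divr_gt0 // exprn_gt0.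
pose p := A x - (s + K)%:C%C *: x.
have [y Dy yp] := regular_surj reg2 p.
have BxE : B x = p + K%:C%C *: x.
  by rewrite /B /p rmorphD /=; apply: inner_extr => u; rewrite !innerE; ring.
have ByE : B y = p - K%:C%C *: y.
  by rewrite /B -yp rmorphB /=; apply: inner_extr => u; rewrite !innerE; ring.
have cross : complex.Re (inner (B x) (B y)) - K ^+ 2 * complex.Re (inner x y) = nrm p ^+ 2.
  have sym : inner (B x) y = inner x (B y).
    by rewrite /B (shift_sym A_sa) // conj_real.
  have : inner p p = inner (B x) (B y) - (K ^+ 2)%:C%C * inner x y.
    have pE1 : p = B x - K%:C%C *: x by rewrite BxE addrK.
    have pE2 : p = B y + K%:C%C *: y by rewrite ByE subrK.
    move: sym pE1 pE2; move: (B x) (B y) => bx b_y sym pE1 pE2.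
    rewrite {1}pE1 pE2 !innerE conj_real sym rmorphXn /=; ring.
  by rewrite nrm2E => ->; rewrite cRe_add cRe_opp cRe_mulr.
have qy : nrm (B y) ^+ 2 <= c2 * nrm p ^+ 2.
  have k0 : 0 <= 1 + K / m2 by rewrite addr_ge0 // divr_ge0 // ltW.
  rewrite /c2 -exprMn ler_pXn2r ?nnegrE ?nrm_ge0 ?mulr_ge0 ?nrm_ge0 //.
  rewrite ByE; apply: le_trans (nrmD _ _) _; rewrite nrmN nrmZ nrm_real ger0_norm //.
  rewrite mulrDl mul1r lerD2l -mulrA ler_wpM2l // ler_pdivlMl //.
  by rewrite -yp; exact: h2.
(* The minimizer of the upper bound q(x) + 2 t |p|^2 + t^2 c2 |p|^2. *)
pose t := - c2^-1.
have [Dty _] := linear_onZ linA t%:C%C Dy.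
have [Dxy _] := linear_onD linA Dx Dty.
have := q_ge0 _ Dxy.
have -> : B (x + t%:C%C *: y) = B x + t%:C%C *: B y.
  by rewrite /B (shiftD A_sa) // (shiftZ A_sa).
rewrite !nrm_lincomb => qxy.
have ny : 0 <= K ^+ 2 * nrm y ^+ 2 by rewrite mulr_ge0 ?sqr_ge0.
have tt : t ^+ 2 * c2 = - t by rewrite /t; field; apply: lt0r_neq0.
have pq : - t * nrm p ^+ 2 <= nrm (B x) ^+ 2 - K ^+ 2 * nrm x ^+ 2.
  have e1 : t ^+ 2 * nrm (B y) ^+ 2 <= - t * nrm p ^+ 2.
    by rewrite -tt -mulrA ler_wpM2l ?sqr_ge0.
  have e2 : 0 <= t ^+ 2 * (K ^+ 2 * nrm y ^+ 2) by rewrite mulr_ge0 ?sqr_ge0.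
  have e3 := congr1 (fun u => t * u) cross; rewrite /= in e3.
  lra.
have px : m1 ^+ 2 * nrm x ^+ 2 <= nrm p ^+ 2.
  have m1' := ltW m10.
  rewrite -exprMn ler_pXn2r ?nnegrE ?nrm_ge0 ?mulr_ge0 ?nrm_ge0 //.
  exact: h1.
have : c2^-1 * (m1 ^+ 2 * nrm x ^+ 2) <= - t * nrm p ^+ 2.
  by rewrite /t opprK ler_wpM2l // invr_ge0 ltW.
rewrite -/(B x); lra.
Qed.

(** The norm of the resolvent is the inverse of the distance to the spectrum:
    were the best constant K smaller than d, the points s + K and s - K would
    both be regular, and the coercivity above would improve K. *)
Lemma dist_spectrum_bound s (d : R) :
  (forall u : R, ~ regular u -> d <= `|s - u|) ->
  forall x, dom A x -> d * nrm x <= nrm (A x - s%:C%C *: x).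
Proof.
move=> far x0 Dx0; rewrite leNgt; apply/negP => lt0.
have x0pos : 0 < nrm x0.
  rewrite lt_def nrm_ge0 andbT; apply: contraTneq lt0 => ->.
  by rewrite mulr0 -leNgt nrm_ge0.
pose S := [set k : R | 0 <= k /\
  forall x, dom A x -> k * nrm x <= nrm (A x - s%:C%C *: x)].
have S0 : S 0 by split => // x _; rewrite mul0r nrm_ge0.
have Sub k : S k -> k <= nrm (A x0 - s%:C%C *: x0) / nrm x0.
  by move=> [_ h]; rewrite ler_pdivlMr // h.
have supS : has_sup S by split; [exists 0 | exists (nrm (A x0 - s%:C%C *: x0) / nrm x0)].
pose K := sup S.
have K0 : 0 <= K by apply: ub_le_sup => //; exact: supS.2.
have Kd : K < d.
  apply: le_lt_trans (_ : nrm (A x0 - s%:C%C *: x0) / nrm x0 < d); last by rewrite ltr_pdivrMr.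
  by apply: ge_sup; [exists 0 | move=> k; exact: Sub].
have Kbnd x : dom A x -> K * nrm x <= nrm (A x - s%:C%C *: x).
  move=> Dx; have [x00|xn0] := eqVneq (nrm x) 0; first by rewrite x00 mulr0 nrm_ge0.
  have xpos : 0 < nrm x by rewrite lt_def xn0 nrm_ge0.
  rewrite -ler_pdivlMr //; apply: ge_sup; first by exists 0.
  by move=> k [_ h]; rewrite ler_pdivlMr // h.
have [c c0 cbnd] : exists2 c : R, 0 < c & forall x, dom A x ->
    (K ^+ 2 + c) * nrm x ^+ 2 <= nrm (A x - s%:C%C *: x) ^+ 2.
  apply: regular_pair_gap => //; apply: contrapT => /far.
    by rewrite opprD addrA subrr add0r normrN ger0_norm // leNgt Kd.
  by rewrite opprB addrC subrK ger0_norm // leNgt Kd.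
(* With this e, (K + e)^2 <= K^2 + e (2 K + 1) <= K^2 + c. *)
pose e := Num.min 1 (c / (2 * K + 1)).
have K1 : 0 < 2 * K + 1 by lra.
have e0 : 0 < e by rewrite lt_min ltr01 divr_gt0.
have e1 : e <= 1 by rewrite ge_min lexx.
have ec : e * (2 * K + 1) <= c by rewrite -ler_pdivlMr // ge_min lexx orbT.
have : S (K + e).
  split=> [|x Dx]; first lra.
  rewrite -(ler_pXn2r (ltn0Sn 1)) ?nnegrE ?nrm_ge0 ?mulr_ge0 ?nrm_ge0 //; last lra.
  apply: le_trans (cbnd x Dx); rewrite exprMn ler_wpM2r ?sqr_ge0 //.
  have : e * e <= e * 1 by rewrite ler_wpM2l // ltW.
  lra.
by move/(ub_le_sup supS.2); rewrite -/K; lra.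
Qed.

Section Cyclic.
Variables (phi : H -> C) (r : H).
Hypothesis phi_lin : linear_on (dom A) (phi : H -> C^o).
Hypothesis rE : forall x, inner r x = phi (resolvent A 'i x).
Hypothesis r_cyc : cyclic_vector A r.

(** A point s of the interval at distance d from the spectrum inherits the bound
    of a nearest spectral point u, because |(A - u)x| is at most
    |(A - s)x| + d |x|, and d |x| is at most |(A - s)x|. The slack e replaces the
    choice of a nearest point, and l itself serves when the distance exceeds a,
    since u must stay within 2 a of l. *)
Lemma functional_bound_spread l a n : 0 < a -> 0 <= n -> ~ regular l ->
  (forall u, `|u - l| < 2 * a -> ~ regular u ->
     forall x, dom A x -> nrm (phi x) <= n * nrm (A x - u%:C%C *: x)) ->
  forall s, `|s - l| < a ->
     forall x, dom A x -> nrm (phi x) <= (2 * n) * nrm (A x - s%:C%C *: x).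
Proof.
move=> a0 n0 lsp bnd s sl x Dx.
have [->|x0] := eqVneq x 0.
  by rewrite (linear_on0 phi_lin) nrm0 mulr_ge0 ?nrm_ge0 // mulr_ge0.
have xpos : 0 < nrm x by rewrite lt_def nrm_eq0 x0 nrm_ge0.
set t := nrm (A x - _ *: x).
have t0 : 0 <= t by exact: nrm_ge0.
suff h (e : R) : 0 < e -> nrm (phi x) <= n * (2 * t + e).
  apply/ler_addgt0Pr => e e0.
  have n1 : 0 < n + 1 by lra.
  apply: le_trans (h (e / (n + 1)) (divr_gt0 e0 n1)) _.
  rewrite mulrDr mulrA (mulrC n 2) lerD2l mulrA ler_pdivrMr // mulrC ler_wpM2l ?ltW //.
  lra.
move=> e0; pose d := (t + e) / nrm x.
have [u [ureg ul us]] : exists u, [/\ ~ regular u, `|u - l| < 2 * a & `|s - u| < d].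
  have [da|ad] := leP d a; last first.
    by exists l; split => //; [rewrite subrr normr0; lra | exact: lt_trans ad].
  apply: contrapT => none.
  have : d * nrm x <= t.
    apply: dist_spectrum_bound => // u ureg; rewrite leNgt; apply/negP => us.
    apply: none; exists u; split => //.
    have := ler_distD s u l; rewrite (distrC u s); lra.
  by rewrite /d divfK ?gt_eqF //; lra.
apply: le_trans (bnd u ul ureg x Dx) _; rewrite ler_wpM2l //.
apply: le_trans (nrm_shift_move s u x) _.
have : `|s - u| * nrm x <= t + e by rewrite -ler_pdivlMr // ltW.
rewrite -/t; lra.
Qed.

Let cay := cayley A.
Let cayi := cayley_inv A.

(** The point w of the unit circle corresponds to the real point
    s = i (w + 1) / (w - 1) under the Cayley transform. *)
Lemma cayley_shift w s x : w != 1 -> s%:C%C = 'i * (w + 1) / (w - 1) ->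
  cay x - w *: x = (1 - w) *: (A (resolvent A 'i x) - s%:C%C *: resolvent A 'i x).
Proof.
move=> w1 ->; rewrite /cay cayleyE //; set y := resolvent A 'i x.
have -> : w *: x = w *: (A y - 'i *: y) by case: (resolventP A_sa x cIm_i_neq0) => _ ->.
have w1' : w - 1 != 0 by rewrite subr_eq0.
by apply: inner_extr => u; rewrite !innerE; field.
Qed.

(** The local bound passes from r to its images under resolvents, which commute
    with the Cayley transform, and hence to their span. *)
Lemma span_local (P : C -> Prop) : 
  (exists2 K, 0 <= K & forall w, P w -> forall y, nrm (inner r y) <= K * nrm (cay y - w *: y)) ->
  forall x, linear_span [set resolvent A z r | z in [set z | z \isn't Num.real]] x ->
  exists2 K, 0 <= K & forall w, P w -> forall y, nrm (inner x y) <= K * nrm (cay y - w *: y).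
Proof.
move=> [K0 K00 hK] x [k [c [v [vS ->]]]].
pose Loc x := exists2 K, 0 <= K &
  forall w, P w -> forall y, nrm (inner x y) <= K * nrm (cay y - w *: y).
apply: (big_ind Loc).
- by exists 0 => // w _ y; rewrite inner0l nrm0 mul0r.
- move=> x1 x2 [K1 K10 h1] [K2 K20 h2]; exists (K1 + K2); first exact: addr_ge0.
  move=> w Pw y; rewrite innerDl mulrDl; apply: le_trans (nrmD _ _) _.
  by rewrite lerD ?h1 ?h2.
move=> j _; have [z zr <-] := vS j.
have zI := Im_nonreal zr.
have zI' : complex.Im z^* != 0 by rewrite cIm_conj oppr_eq0.
exists (nrm (c j) * (K0 / `|complex.Im z|)).
  by rewrite mulr_ge0 ?nrm_ge0 ?divr_ge0.
move=> w Pw y; rewrite innerZl nrmM nrm_conj -mulrA ler_wpM2l ?nrm_ge0 //.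
rewrite (resolvent_adj A_sa) //; apply: le_trans (hK w Pw _) _.
rewrite -mulrA ler_wpM2l // mulrC.
have -> : cay (resolvent A z^* y) - w *: resolvent A z^* y
    = resolvent A z^* (cay y - w *: y).
  rewrite /cay cayley_comm // -!scaleNr addrC -(resolvent_lin A_sa) // addrC //.
apply: le_trans (resolvent_le A_sa _ zI') _.
by rewrite cIm_conj normrN.
Qed.

(** In terms of the spectral measure mu of r, the hypothesis bounds the integral
    of (y - u)^-2 dmu(y) uniformly for u in the spectrum near l. An interval of
    length h around such a u then has mass O(h^2); cutting an interval into
    1/h pieces shows that mu has no mass near l, and cyclicity removes l from
    the spectrum. The covering argument is carried out for the Cayley
    transform, with unitary_local_bound in place of the spectral measure. *)
Lemma local_regular l a n : 0 < a -> 0 <= n ->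
  (forall u, `|u - l| < 2 * a -> ~ regular u ->
     forall x, dom A x -> nrm (phi x) <= n * nrm (A x - u%:C%C *: x)) ->
  regular l.
Proof.
move=> a0 n0 bnd; apply: contrapT => lsp.
have bnd' := functional_bound_spread a0 n0 lsp bnd.
have li0 : l%:C%C - 'i != 0 :> C.
  apply/eqP => /(congr1 (@complex.Im R)); rewrite -complexiE /= => /eqP.
  by rewrite sub0r oppr_eq0 oner_eq0.
have li0' : l%:C%C + 'i != 0 :> C.
  apply/eqP => /(congr1 (@complex.Im R)); rewrite -complexiE /= => /eqP.
  by rewrite add0r oner_eq0.
have i0 : 'i != 0 :> C by exact: neq0Ci.
have two0 : 2 != 0 :> C by rewrite pnatr_eq0.
have ii := @mulii R.
(* The image of l on the unit circle. *)
pose w0 : C := (l%:C%C + 'i) / (l%:C%C - 'i).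
have w0c : w0^* = (l%:C%C - 'i) / (l%:C%C + 'i).
  by rewrite /w0 fmorph_div rmorphD rmorphB /= conj_real conjCi opprK.
have w01 : w0 - 1 = 2 * 'i / (l%:C%C - 'i) by rewrite /w0; field.
have w01n : w0 - 1 != 0 by rewrite w01 !mulf_neq0 ?invr_eq0.
pose q := nrm (w0 - 1).
have q0 : 0 < q by rewrite lt_def nrm_eq0 w01n nrm_ge0.
have lE : l%:C%C = 'i * (w0 + 1) / (w0 - 1).
  by rewrite w01 /w0; field; rewrite ?li0 ?i0.
(* Within rho of w0, w stays away from 1 and its real point within a of l. *)
pose rho := Num.min (q / 2) (a * q ^+ 2 / 4).
have rho0 : 0 < rho by rewrite lt_min !divr_gt0 // mulr_gt0 // exprn_gt0.
pose P w := nrm w = 1 /\ nrm (w - w0) < rho.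
have r_loc : exists2 K, 0 <= K &
    forall w, P w -> forall y, nrm (inner r y) <= K * nrm (cay y - w *: y).
  exists (2 * n * (2 / q)); first by rewrite mulr_ge0 ?divr_ge0 ?mulr_ge0 // ltW.
  move=> w [w1 wnear] y.
  have wq : nrm (w - w0) < q / 2 by apply: lt_le_trans wnear _; rewrite ge_min lexx.
  have wa : nrm (w - w0) < a * q ^+ 2 / 4.
    by apply: lt_le_trans wnear _; rewrite ge_min lexx orbT.
  have w1q : q / 2 <= nrm (w - 1).
    have := nrm_tri w0 w 1; rewrite (nrm_distC w0 w) -/q; lra.
  have w1n : w - 1 != 0.
    rewrite -nrm_eq0; apply: lt0r_neq0; apply: lt_le_trans w1q; lra.
  have w0n : w != 0 by rewrite -nrm_eq0 w1 oner_eq0.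
  pose zs : C := 'i * (w + 1) / (w - 1).
  have wc : w^* = w^-1.
    by apply: (mulfI w0n); rewrite nrm1_conj // divff.
  have zsr : zs^* = zs.
    rewrite /zs fmorph_div rmorphM rmorphD rmorphB rmorph1 /= conjCi wc.
    by field; rewrite w0n w1n mulN1r -oppr_eq0 opprB /=.
  pose s := complex.Re zs.
  have sE : s%:C%C = zs by rewrite RRe_real //; apply/CrealP.
  have sl : `|s - l| < a.
    rewrite -nrm_real rmorphB /= sE lE.
    have -> : zs - 'i * (w0 + 1) / (w0 - 1)
        = (2 * 'i) * (w0 - w) / ((w - 1) * (w0 - 1)).
      by rewrite /zs; field; rewrite w1n w01n.
    rewrite !nrmM nrmV nrmM nrm_i nrm_nat mulr1 -/q (nrm_distC w0).
    rewrite ltr_pdivrMr; last by rewrite mulr_gt0 // (lt_le_trans _ w1q) // divr_gt0.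
    have : a * (q / 2 * q) <= a * (nrm (w - 1) * q).
      by rewrite ler_pM2l // ler_pM2r.
    lra.
  rewrite rE; apply: le_trans (bnd' s sl _ (resolvent_dom A_sa _ cIm_i_neq0)) _.
  rewrite -[leRHS]mulrA ler_wpM2l ?mulr_ge0 //.
  rewrite (@cayley_shift w s) //; last by rewrite -subr_eq0.
  rewrite nrmZ mulrA -[leLHS]mul1r ler_wpM2r ?nrm_ge0 //.
  rewrite nrm_distC mulrAC -ler_pdivrMr ?invr_gt0 // invrK mul1r.
  lra.
have U_loc x : rho / 2 * nrm x <= nrm (cayi x - w0^* *: x).
  have spanb y : linear_span [set resolvent A z r | z in [set z | z \isn't Num.real]] y ->
      rho / 2 * nrm y <= nrm (cayi y - w0^* *: y).
    move=> /(span_local r_loc)[K K0 hK].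
    have := @unitary_local_bound R H cayi cay w0 rho K y (cayley_inv_lin A_sa)
      (cayley_lin A_sa) (nrm_cayley_inv A_sa) (nrm_cayley A_sa) (cayley_adj A_sa) rho0 K0.
    move=> h; have {}h : rho ^+ 2 * nrm y ^+ 2 <= 2 * nrm (cayi y - w0^* *: y) ^+ 2.
      by apply: h => w w1 ww0; apply: hK.
    rewrite -(ler_pXn2r (ltn0Sn 1)) ?nnegrE ?nrm_ge0 //; last first.
      by rewrite mulr_ge0 ?nrm_ge0 // divr_ge0 // ltW.
    have : 0 <= rho ^+ 2 * nrm y ^+ 2 by rewrite mulr_ge0 ?sqr_ge0.
    rewrite !exprMn; lra.
  apply/ler_addgt0Pr => e e0.
  have b0 : 0 < rho / 2 + 1 + nrm w0 by have := nrm_ge0 w0; lra.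
  have [y ySpan yx] : exists2 y, linear_span [set resolvent A z r | z in
      [set z | z \isn't Num.real]] y & nrm (x - y) < e / (rho / 2 + 1 + nrm w0).
    by apply: closureP; [rewrite r_cyc | rewrite divr_gt0].
  have h1 := spanb y ySpan.
  have h2 : nrm (cayi y - w0^* *: y) <=
      nrm (cayi x - w0^* *: x) + (1 + nrm w0) * nrm (x - y).
    have yE : y = (-1) *: (x - y) + x by rewrite scaleN1r opprB subrK.
    have -> : cayi y - w0^* *: y = (cayi x - w0^* *: x) -
        (cayi (x - y) - w0^* *: (x - y)).
      rewrite {1 2}yE /cayi (cayley_inv_lin A_sa).
      by apply: inner_extr => u; rewrite !innerE; ring.
    apply: le_trans (nrmD _ _) _; rewrite lerD2l nrmN.
    apply: le_trans (nrmD _ _) _.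
    by rewrite nrmN nrmZ nrm_conj nrm_cayley_inv // mulrDl mul1r.
  have h3 : rho / 2 * nrm x <= rho / 2 * nrm y + rho / 2 * nrm (x - y).
    rewrite -mulrDr ler_pM2l ?divr_gt0 // addrC -lerBlDr; exact: nrm_sub_ge.
  have h4 : nrm (x - y) * (rho / 2 + 1 + nrm w0) <= e by rewrite -ler_pdivlMr // ltW.
  lra.
apply: lsp; exists (rho / 2 / q); first by rewrite !divr_gt0.
move=> x Dx; rewrite mulrAC ler_pdivrMr //.
pose y := A x - (- 'i) *: x.
have Ry : resolvent A (- 'i) y = x by apply: (resolvent_eqP A_sa cIm_Ni_neq0 Dx).
have xy : nrm x <= nrm y.
  have := shift_ge_Im A_sa (- 'i) Dx.
  by rewrite -complexiE /= normrN normr1 mul1r complexiE.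
have Uy : cayi y - w0^* *: y = (1 - w0^* ) *: (A x - l%:C%C *: x).
  rewrite /cayi cayley_invE // Ry /y w0c.
  apply: inner_extr => u; rewrite !innerE; field; exact: li0'.
apply: le_trans (_ : rho / 2 * nrm y <= _); first by rewrite ler_pM2l ?divr_gt0.
apply: le_trans (U_loc y) _.
have qE : nrm (1 - w0^* ) = q.
  by rewrite -nrm_conj rmorphB rmorph1 /= conjCK nrm_distC.
by rewrite Uy nrmZ qE mulrC.
Qed.

End Cyclic.
End LocalRegularity.
(** * The graph norm of the absolute value *)
Section AbsoluteValue.
Context {R : realType} {H : hilbertType R}.
Local Notation C := R[i].
Implicit Types (x y v : H).

(** The domain of the square of A is a core: J = - i t (A - i t)^-1 tends
    strongly to the identity as t grows, maps into the domain of A, and commutes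
    with A. *)
Lemma square_domain_approx (A : @operator R H) (A_sa : self_adjoint A) x (e : R) :
  dom A x -> 0 < e -> exists y, [/\ dom A y, dom A (A y), nrm (x - y) < e &
    nrm (A x - A y) < e].
Proof.
move=> Dx e0; have linA : linear_on (dom A) A by case: A_sa.
have [v Dv Axv] : exists2 v, dom A v & nrm (A x - v) < e / 4.
  by apply: sa_dense; rewrite ?divr_gt0.
pose t := (nrm (A x) + nrm (A v) + 1) * 4 / e.
have nx := nrm_ge0 (A x); have nv := nrm_ge0 (A v).
have t0 : 0 < t by rewrite divr_gt0 // mulr_gt0 //; lra.
pose z : C := t%:C%C * 'i.
have zE : z = (Complex 0 t) by rewrite /z -complexiE; apply/eqP; rewrite eq_complex /= !mulr0 !mul0r mulr1 subrr addr0 !eqxx.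
have zt : complex.Im z = t by rewrite zE.
have z0 : complex.Im z != 0 by rewrite zt gt_eqF.
have nz : nrm z = t by rewrite /z nrmM nrm_real nrm_i mulr1 gtr0_norm.
pose J u := - z *: resolvent A z u.
have RA u : dom A u -> A (resolvent A z u) = resolvent A z (A u).
  move=> Du; have h : resolvent A z (A u - z *: u) = u by apply: resolvent_eqP.
  have : A u = z *: u + (A u - z *: u) by rewrite addrC subrK.
  by move=> ->; rewrite (resolvent_lin A_sa) // h resolventK // addrC.
have JB u : u - J u = A (resolvent A z u).
  by rewrite /J resolventK // scaleNr opprK.
have Jnear u : dom A u -> nrm (u - J u) <= nrm (A u) / t.
  move=> Du; rewrite JB RA //; apply: le_trans (resolvent_le A_sa _ z0) _.
  by rewrite zt gtr0_norm.
have Jle u : nrm (J u) <= nrm u.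
  rewrite /J nrmZ nrmN nz mulrC -ler_pdivlMr //.
  by apply: le_trans (resolvent_le A_sa _ z0) _; rewrite zt gtr0_norm.
have DJ u : dom A (J u) by exact: (linear_onZ linA _ (resolvent_dom A_sa u z0)).1.
have AJ : A (J x) = J (A x).
  by rewrite /J (linear_onZ linA _ (resolvent_dom A_sa x z0)).2 RA.
have small u : nrm (A u) <= nrm (A x) + nrm (A v) -> nrm (A u) / t < e / 4.
  move=> h; rewrite ltr_pdivrMr //.
  have -> : e / 4 * t = nrm (A x) + nrm (A v) + 1.
    by rewrite /t; field; apply: lt0r_neq0.
  lra.
exists (J x); split => //; first by rewrite AJ.
  have := Jnear x Dx; have := small x; lra.
rewrite AJ.
have -> : A x - J (A x) = (A x - v) + (v - J v) - J (A x - v).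
  have -> : J (A x - v) = J (A x) - J v.
    rewrite /J; have -> : A x - v = (-1) *: v + A x by rewrite addrC scaleN1r.
    by rewrite (resolvent_lin A_sa) //; apply: inner_extr => u; rewrite !innerE; ring.
  by apply: inner_extr => u; rewrite !innerE; ring.
have h1 := nrmD (A x - v + (v - J v)) (- J (A x - v)).
have h2 := nrmD (A x - v) (v - J v).
rewrite nrmN in h1; have h3 := Jle (A x - v); have h4 := Jnear v Dv.
have := small v; lra.
Qed.

(** On the common domain of the squares, |B x|^2 = <x, B^2 x> = <x, A^2 x> =
    |A x|^2. Since this domain is a core of A, the functional v |-> <x, B v> is
    bounded by |A x| |v| for each x in the domain of A, and maximality of B
    concludes. *)
Lemma abs_domain (A B : @operator R H) : self_adjoint A -> is_abs A B ->
  forall x, dom A x -> dom B x /\ nrm (B x) <= nrm (A x).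
Proof.
move=> A_sa [B_sa _ [domE valE]] x Dx.
have linB : linear_on (dom B) B by case: B_sa.
have sqE y : dom A y -> dom A (A y) -> dom B y /\ nrm (B y) = nrm (A y).
  move=> Dy DAy.
  have D2 : dom (op_square A) y by split.
  have [DBy DBBy] : dom (op_square B) y by rewrite domE.
  split => //; apply/eqP; rewrite -(eqrXn2 (n := 2)) ?nrm_ge0 // !nrm2E.
  rewrite -(sa_sym B_sa DBy DBBy) -(sa_sym A_sa Dy DAy).
  by rewrite -[A (A y)]/(op_square A y) -valE.
have bnd v : dom B v -> nrm (inner x (B v)) <= nrm (A x) * nrm v.
  move=> Dv; apply/ler_addgt0Pr => e e0.
  pose d := e / (nrm (B v) + nrm v + 1).
  have p0 : 0 < nrm (B v) + nrm v + 1 by have := nrm_ge0 (B v); have := nrm_ge0 v; lra.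
  have d0 : 0 < d by rewrite divr_gt0.
  have [y [Dy DAy xy Axy]] := square_domain_approx A_sa Dx d0.
  have [DBy nBy] := sqE y Dy DAy.
  have -> : inner x (B v) = inner (B y) v + inner (x - y) (B v).
    by rewrite -(sa_sym B_sa DBy Dv) -innerDl addrC subrK.
  apply: le_trans (nrmD _ _) _.
  have h1 := inner_le_nrm (B y) v; have h2 := inner_le_nrm (x - y) (B v).
  have h3 : nrm (B y) * nrm v <= (nrm (A x) + d) * nrm v.
    rewrite ler_wpM2r ?nrm_ge0 // nBy.
    have := nrm_sub_ge (A y) (A x); rewrite (nrm_distC (A y)); lra.
  have h4 : nrm (x - y) * nrm (B v) <= d * nrm (B v).
    by rewrite ler_wpM2r ?nrm_ge0 // ltW.
  have h5 : d * (nrm (B v) + nrm v + 1) = e by rewrite /d divfK // gt_eqF.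
  lra.
have [||||z [nz zE _]] := @variational_riesz R H (dom B) id (fun v => inner x (B v)) (nrm (A x)).
- split; first exact: linear_on_dom0 linB.
  by move=> a u v Du Dv; split; [exact: (linB.2 a u v Du Dv).1|].
- split; first exact: linear_on_dom0 linB.
  move=> a u v Du Dv; have [Dauv ->] := linB.2 a u v Du Dv.
  by rewrite innerDr innerZr.
- exact: nrm_ge0.
- exact: bnd.
have [DBx Bx] := @sa_max _ _ _ B_sa x z (fun v Dv => esym (zE v Dv)).
by rewrite Bx.
Qed.

Lemma Hm2_bound (A : @operator R H) (phi : H -> C) : self_adjoint A -> in_Hm2 A phi ->
  linear_on (dom A) (phi : H -> C^o) /\
  exists2 M : R, 0 <= M & forall x, dom A x -> nrm (phi x) <= M * (nrm (A x) + nrm x).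
Proof.
move=> A_sa [B [AB phi_lin [M hM]]]; have abs := abs_domain A_sa AB.
have linA : linear_on (dom A) A by case: A_sa.
split.
  split; first exact: linear_on_dom0 linA.
  move=> a x y Dx Dy; split; first exact: (linA.2 a x y Dx Dy).1.
  exact: (phi_lin.2 a x y (abs x Dx).1 (abs y Dy).1).2.
exists `|M| => // x Dx; have [DBx nBx] := abs x Dx.
have : nrm (phi x) <= M * nrm (B x + x).
  by rewrite -lecR rmorphM /= -!nrmC; exact: hM.
move/le_trans; apply; apply: (@le_trans _ _ (`|M| * nrm (B x + x))).
  by rewrite ler_wpM2r ?nrm_ge0 // ler_norm.
rewrite ler_wpM2l //; apply: le_trans (nrmD _ _) _; by rewrite lerD2r.
Qed.

End AbsoluteValue.

(** * The spectrum of a self-adjoint operator *)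
Section Spectrum.
Context {R : realType} {H : hilbertType R}.
Local Notation C := R[i].
Variable A : @operator R H.
Hypothesis A_sa : self_adjoint A.
Let linA : linear_on (dom A) A. Proof. by case: A_sa. Qed.

Lemma resolvent_setP (z : C) (m : R) : 0 < m ->
  (forall x, dom A x -> m * nrm x <= nrm (A x - z *: x)) ->
  resolvent_set A z.
Proof.
move=> m0 bnd.
have bnd' x : dom A x -> m * nrm x <= nrm (A x - z^* *: x).
  by move=> Dx; rewrite nrm_shift_conj //; exact: bnd.
split.
  move=> y; have [x Dx xy] := shift_surj A_sa m0 bnd' y.
  exists x; split => // x' [Dx' x'y].
  have [Dd _] := linear_onB linA Dx Dx'.
  have := bnd _ Dd; rewrite (shiftB A_sa) // xy x'y subrr nrm0.
  rewrite pmulr_rle0 // => h; apply/eqP.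
  by rewrite -subr_eq0 -nrm_eq0 eq_le h nrm_ge0.
exists m^-1 => x Dx; rewrite !nrmC -rmorphM lecR mulrC ler_pdivlMr // mulrC.
exact: bnd.
Qed.

Lemma spectrumP (z : C) : spectrum A z -> exists2 s : R, z = s%:C%C & ~ regular A s.
Proof.
move=> zs; exists (complex.Re z); last first.
  move=> [m m0 bnd]; apply: zs; apply: (resolvent_setP m0) => x Dx.
  by apply: le_trans (bnd x Dx) _; exact: shift_ge_Re.
apply: complex_eqP => //=; apply/eqP; apply: contrapT => z0; apply: zs.
apply: (@resolvent_setP _ `|complex.Im z|).
  by rewrite normr_gt0; apply/negP.
by move=> x Dx; exact: shift_ge_Im.
Qed.

Lemma spectrum_real (s : R) : ~ regular A s -> spectrum A s%:C%C.
Proof.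
move=> sreg [_ [M hM]]; apply: sreg; exists (`|M| + 1)^-1.
  by rewrite invr_gt0 ltr_wpDl.
move=> x Dx; rewrite mulrC ler_pdivrMr; last by rewrite ltr_wpDl.
have : nrm x <= M * nrm (A x - s%:C%C *: x).
  by rewrite -lecR rmorphM /= -!nrmC; exact: hM.
move/le_trans; apply; rewrite mulrC ler_wpM2l ?nrm_ge0 //.
by have := ler_norm M; lra.
Qed.

Lemma regular_open (s : R) : regular A s ->
  exists2 d : R, 0 < d & forall t, `|s - t| < d -> regular A t.
Proof.
move=> [m m0 bnd]; exists (m / 2) => [|t st]; first by rewrite divr_gt0.
exists (m / 2) => [|x Dx]; first by rewrite divr_gt0.
have h1 := bnd x Dx; have h2 := nrm_shift_move A t s x.
have : `|t - s| * nrm x <= m / 2 * nrm x.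
  by rewrite ler_wpM2r ?nrm_ge0 // distrC ltW.
lra.
Qed.

End Spectrum.

(** * Eigenvalues of singular rank-one perturbations *)
Section RankOne.
Context {R : realType} {H : hilbertType R}.
Local Notation C := R[i].
Implicit Types (x y v : H) (s t : R).
Variables (A : @operator R H) (phi : H -> C).
Hypothesis A_sa : self_adjoint A.
Hypothesis phi_Hm2 : in_Hm2 A phi.
Hypothesis phi_sing : ~ in_H A phi.
Let linA : linear_on (dom A) A. Proof. by case: A_sa. Qed.
Let phi_lin : linear_on (dom A) (phi : H -> C^o).
Proof. by case: (Hm2_bound A_sa phi_Hm2). Qed.

Lemma gen_resolventE (z : C) x : complex.Im z != 0 ->
  inner (gen_resolvent A phi z) x = phi (resolvent A z^* x).
Proof.
move=> z0; have z0' : complex.Im z^* != 0 by rewrite cIm_conj oppr_eq0.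
have [_ [M M0 hM]] := Hm2_bound A_sa phi_Hm2.
have [|||u uE] := @riesz R H (fun v => phi (resolvent A z^* v))
    (M * (1 + nrm z / `|complex.Im z| + `|complex.Im z|^-1)).
- by rewrite mulr_ge0 // !addr_ge0 ?divr_ge0 ?nrm_ge0 ?invr_ge0.
- move=> a u v; rewrite (resolvent_lin A_sa) //.
  by rewrite (phi_lin.2 a _ _ (resolvent_dom A_sa u z0') (resolvent_dom A_sa v z0')).2.
- move=> v; apply: le_trans (hM _ (resolvent_dom A_sa v z0')) _.
  rewrite -mulrA ler_wpM2l // resolventK //.
  have h1 := nrmD v (z^* *: resolvent A z^* v).
  have h2 := resolvent_le A_sa v z0'; rewrite cIm_conj normrN in h2.
  rewrite nrmZ nrm_conj in h1.
  have h3 : nrm z * nrm (resolvent A z^* v) <= nrm z * (nrm v / `|complex.Im z|).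
    by rewrite ler_wpM2l ?nrm_ge0.
  lra.
exact: (xgetPex 0 (ex_intro _ u uE : exists u, forall eta, inner u eta = phi (resolvent A z^* eta))).
Qed.

(** The kernel of phi is dense: a nonzero vector orthogonal to it would represent
    phi. This makes the adjoint of dotA single-valued. *)
Lemma kernel_orth v : (forall x, dom A x -> phi x = 0 -> inner v x = 0) -> v = 0.
Proof.
move=> vker.
have [x0 Dx0 px0] : exists2 x, dom A x & phi x != 0.
  apply: contrapT => none; apply: phi_sing; exists 0 => x Dx.
  rewrite inner0l; apply/eqP; apply: contrapT => /negP px; apply: none.
  by exists x.
pose x1 := (phi x0)^-1 *: x0.
have [Dx1 px1] : dom A x1 /\ phi x1 = 1.
  have [D1 p1] := linear_onZ phi_lin (phi x0)^-1 Dx0.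
  by split => //; rewrite /x1 p1; exact: mulVf.
have vE x : dom A x -> inner v x = phi x * inner v x1.
  move=> Dx; have [Dz pz] := linear_onZ phi_lin (phi x) Dx1.
  have [Dd pd] := linear_onB phi_lin Dx Dz.
  have := vker _ Dd; rewrite pd pz px1.
  have -> : phi x - (phi x *: (1 : C^o)) = 0 by rewrite -[_ *: _]/(phi x * 1) mulr1 subrr.
  by move=> /(_ erefl) /eqP; rewrite !innerE subr_eq0 => /eqP.
have [v1|v1] := eqVneq (inner v x1) 0.
  by apply: (sa_orth A_sa) => x Dx; rewrite vE // v1 mulr0.
exfalso; apply: phi_sing; exists ((inner v x1)^-1^* *: v) => x Dx.
by rewrite innerZl conjCK (vE x Dx) mulrCA mulVf // mulr1.
Qed.

Local Notation sv := (sing_vec A phi).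

(** Formally A sv = phi - w with w = (A^2 + I)^-1 phi. *)
Lemma sing_vecE : exists w, forall x, dom A x -> inner sv (A x) = phi x - inner w x.
Proof.
pose rp := gen_resolvent A phi 'i; pose rm := gen_resolvent A phi (- 'i).
have rpE x : inner rp x = phi (resolvent A (- 'i) x).
  by rewrite gen_resolventE ?conjCi // cIm_i_neq0.
have rmE x : inner rm x = phi (resolvent A 'i x).
  by rewrite gen_resolventE ?rmorphN /= ?conjCi ?opprK // cIm_Ni_neq0.
have i0 : 'i != 0 :> C by exact: neq0Ci.
have ii := @mulii R.
exists (('i / 2) *: (rm - rp)) => x Dx.
rewrite /sing_vec -/rp -/rm innerZl innerDl.
have lin1 (z : C) : complex.Im z != 0 ->
    phi (resolvent A z (A x)) = phi x + z * phi (resolvent A z x).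
  move=> z0; have Dr := resolvent_dom A_sa x z0.
  have -> : resolvent A z (A x) = z *: resolvent A z x + x.
    have h : resolvent A z (A x - z *: x) = x by apply: (resolvent_eqP A_sa).
    have := resolvent_lin A_sa z x (A x - z *: x) z0.
    by rewrite h addrC subrK.
  by rewrite (phi_lin.2 z _ _ Dr Dx).2 addrC.
rewrite rpE rmE !lin1 ?cIm_i_neq0 ?cIm_Ni_neq0 // innerZl innerDl innerNl rpE rmE.
rewrite rmorphM /= conjCi !fmorphV !rmorph_nat.
by field.
Qed.

Hypothesis phi_cyclic : cyclic_vector A (gen_resolvent A phi (- 'i)).
Local Notation r := (gen_resolvent A phi (- 'i)).

Lemma cyclic_rE x : inner r x = phi (resolvent A 'i x).
Proof. by rewrite gen_resolventE ?rmorphN /= ?conjCi ?opprK // cIm_Ni_neq0. Qed.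

(** Such a vector is orthogonal to every resolvent of the cyclic vector. *)
Lemma no_eigenvector_in_kernel s x :
  dom A x -> A x = s%:C%C *: x -> phi x = 0 -> x = 0.
Proof.
move=> Dx Ax px.
have Rx (z : C) : complex.Im z != 0 -> resolvent A z x = (s%:C%C - z)^-1 *: x.
  move=> z0; have sz : s%:C%C - z != 0.
    case: z z0 => a b /= b0; apply/eqP => /(congr1 (@complex.Im R)) /= /eqP.
    by rewrite sub0r oppr_eq0 (negPf b0).
  apply: (resolvent_eqP A_sa z0); first exact: (linear_onZ linA _ Dx).1.
  by rewrite (shiftZ A_sa) // Ax -scalerBl scalerA mulVf // scale1r.
apply: (dense_orthogonal (D := linear_span [set resolvent A z r | z in
    [set z | z \isn't Num.real]])).
  by move=> v e e0; apply: closureP; rewrite ?phi_cyclic.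
move=> _ [k [c [v [vS ->]]]]; rewrite inner_sumr big1 // => j _.
have [z zr <-] := vS j; rewrite innerZr innerC.
have z0 := Im_nonreal zr.
have z0' : complex.Im z^* != 0 by rewrite cIm_conj oppr_eq0.
rewrite (resolvent_adj A_sa) // Rx // innerZr cyclic_rE Rx ?cIm_i_neq0 //.
have -> : phi ((s%:C%C - 'i)^-1 *: x) = 0.
  by rewrite (linear_onZ phi_lin _ Dx).2 px -[_ *: _]/(_ * 0) mulr0.
by rewrite mulr0 rmorph0 mulr0.
Qed.

(** y is (A - s)^-1 phi in the weak sense. Such a y may exist at a spectral
    point s; formally its squared norm is the integral of (u - s)^-2 dmu(u). *)
Definition weak_sol s y := forall x, dom A x -> inner y (A x - s%:C%C *: x) = phi x.

Lemma weak_sol_dom s y : weak_sol s y -> dom A (y - sv).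
Proof.
move=> sol; have [w] := sing_vecE; move: sv => q wE.
apply: (@sa_max _ _ _ A_sa _ (s%:C%C *: y + w) _).1 => x Dx.
have := sol x Dx; rewrite !innerE wE // conj_real => <-; ring.
Qed.

(** The last clause gives the weak continuity of solutions in s: y is a limit of
    vectors (A - s)x, whose inner products with solutions at other points are
    explicit. *)
Lemma weak_sol_exists s n : 0 <= n ->
  (forall x, dom A x -> nrm (phi x) <= n * nrm (A x - s%:C%C *: x)) ->
  exists y, [/\ nrm y <= n, weak_sol s y &
    forall e : R, 0 < e -> exists2 x, dom A x & nrm (y - (A x - s%:C%C *: x)) < e].
Proof.
move=> n0 bnd.
apply: (@variational_riesz R H (dom A) (fun x => A x - s%:C%C *: x) phi n) => //.
exact: shift_linear_on.
Qed.

Lemma weak_sol_bound s y : weak_sol s y ->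
  forall x, dom A x -> nrm (phi x) <= nrm y * nrm (A x - s%:C%C *: x).
Proof. by move=> sol x Dx; rewrite -sol //; exact: inner_le_nrm. Qed.

(** First resolvent identity for weak solutions. *)
Lemma weak_sol_sub s t y y' : weak_sol s y -> weak_sol t y' ->
  [/\ dom A (y - y'),
      A (y - y') - s%:C%C *: (y - y') = (s - t)%:C%C *: y' &
      phi (y - y') = (s - t)%:C%C * inner y y'].
Proof.
move=> sy ty.
have D : dom A (y - y').
  have -> : y - y' = (y - sv) - (y' - sv).
    by apply: inner_extr => u; rewrite !innerE; ring.
  exact: (linear_onB linA (weak_sol_dom sy) (weak_sol_dom ty)).1.
have E : A (y - y') - s%:C%C *: (y - y') = (s - t)%:C%C *: y'.
  apply/eqP; rewrite -subr_eq0; apply/eqP/(sa_orth A_sa) => x Dx.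
  have := sy x Dx; have := ty x Dx; rewrite !innerE.
  rewrite -(sa_sym A_sa D Dx) !innerE !conj_real rmorphB /= => h1 h2.
  have -> : inner y (A x) = phi x + s%:C%C * inner y x by rewrite -h2; ring.
  have -> : inner y' (A x) = phi x + t%:C%C * inner y' x by rewrite -h1; ring.
  ring.
by split => //; rewrite -(sy _ D) E innerZr.
Qed.

Lemma weak_sol_unique s y y' : weak_sol s y -> weak_sol s y' -> y = y'.
Proof.
move=> sy sy'; have [D E P] := weak_sol_sub sy sy'.
apply/eqP; rewrite -subr_eq0; apply/eqP.
apply: (@no_eigenvector_in_kernel s) => //; last by rewrite P subrr mul0r.
by apply/eqP; rewrite -subr_eq0 E subrr scale0r.
Qed.

(** Pairing an eigenvector y = u + b sv with (A - s)x gives b^* phi x, because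
    the kernel of phi is dense. If b = 0 the eigenvector would be an eigenvector
    of A in the kernel of phi, against cyclicity; otherwise b^-1 y is a weak
    solution and the boundary condition fixes phi (b^-1 u). *)
Lemma eigenvalue_weak_sol (c alpha s : R) : alpha != 0 ->
  point_spectrum (rank_one_pert A phi c alpha) s%:C%C ->
  exists2 y, weak_sol s y & 1 + alpha%:C%C * (phi (y - sv) + c%:C%C) = 0.
Proof.
move=> alpha0 [y [[u [b [Du yE bc]]] y0 Ay]].
have [w] := sing_vecE; move: yE; move: sv => q yE wE.
have val : adjoint_val (dotA A phi) y (A u - b *: w).
  move=> x [Dx px] /=; rewrite yE !innerE wE // px (sa_sym A_sa) //.
  ring.
have Ay' : A u - b *: w = s%:C%C *: y.
  rewrite -Ay; symmetry; apply: adjointP val => v hv.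
  by apply: kernel_orth => x Dx px; apply: hv.
have key x : dom A x -> inner y (A x - s%:C%C *: x) = b^* * phi x.
  move=> Dx; have : inner (s%:C%C *: y) x = inner (A u - b *: w) x by rewrite Ay'.
  rewrite innerZl conj_real [in RHS]innerDl innerNl innerZl -(sa_sym A_sa) // => h.
  rewrite innerDr innerNr innerZr h {1}yE innerDl innerZl wE //; ring.
have [b0|b0] := eqVneq b 0.
  exfalso; move/eqP: y0; apply.
  have yu : y = u by rewrite yE b0 scale0r addr0.
  apply: (@no_eigenvector_in_kernel s); rewrite yu //.
    by move: Ay'; rewrite b0 scale0r subr0 yu.
  move: bc; rewrite b0 mul0r addr0 add0r => /eqP.
  rewrite mulf_eq0 => /orP[/eqP/(congr1 (@complex.Re R)) /= h|/eqP //].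
  by move: alpha0; rewrite h eqxx.
exists (b^-1 *: y).
  move=> x Dx; rewrite innerZl key // mulrA -rmorphM mulVf // rmorph1 mul1r //.
have -> : b^-1 *: y - q = b^-1 *: u.
  by rewrite yE scalerDr scalerA mulVf // scale1r addrK.
rewrite (linear_onZ phi_lin _ Du).2.
have -> : b^-1 *: phi u = b^-1 * phi u :> C^o by [].
apply: (mulfI b0); rewrite mulr0 -[RHS]bc; field; exact: b0.
Qed.

End RankOne.
(** * Baire category on the real line *)
Section RealTopology.
Context {R : realType}.
Implicit Types (x y s t d : R) (S Q E : set R).

(** Closedness stated with radii, the form in which it is established and
    used; eps_closedP identifies it with the topological notion. *)
Definition eps_closed S := forall x, ~ S x ->
  exists2 d, 0 < d & forall t, `|x - t| < d -> ~ S t.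

Lemma eps_closed_adherent S x : eps_closed S ->
  (forall d, 0 < d -> exists2 t, S t & `|x - t| < d) -> S x.
Proof.
move=> cS h; apply: contrapT => /cS[d d0 hd].
by have [t St xt] := h d d0; exact: (hd t xt).
Qed.

Lemma eps_closed_intro S :
  (forall x, (forall d, 0 < d -> exists2 t, S t & `|x - t| < d) -> S x) -> eps_closed S.
Proof.
move=> h x nSx; apply: contrapT => none; apply: nSx; apply: h => d d0.
apply: contrapT => nt; apply: none; exists d => // t xt St; apply: nt.
by exists t.
Qed.

Lemma eps_closedP S : eps_closed S <-> closed S.
Proof.
split=> cS.
  rewrite -openC openE => x /= nSx.
  have [d d0 hd] := cS x nSx.
  exists d => //= t /=; exact: hd.
move=> x nSx; have : open (~` S) by rewrite openC.
rewrite openE => /(_ x nSx)[d /= d0 hd]; exists d => // t xt; exact: hd.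
Qed.

Lemma eps_closedI S Q : eps_closed S -> eps_closed Q -> eps_closed (S `&` Q).
Proof. by move=> /eps_closedP cS /eps_closedP cQ; apply/eps_closedP; exact: closedI. Qed.

(** Baire's theorem inside the closed set S, by nested intervals centred in S
    that avoid one more F n at each step. *)
Lemma baire_closed S (F : nat -> set R) : eps_closed S ->
  (forall n, eps_closed (F n)) ->
  (forall n x d, S x -> 0 < d -> exists t, [/\ S t, `|x - t| < d & ~ F n t]) ->
  forall x d, S x -> 0 < d -> exists t, [/\ S t, `|x - t| < d & forall n, ~ F n t].
Proof.
move=> cS cF nd x d Sx d0.
pose P (np : nat * (R * R)) (q : R * R) := let: (n, p) := np in
  S p.1 -> 0 < p.2 -> [/\ S q.1, 0 < q.2, `|p.1 - q.1| + q.2 <= p.2,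
    q.2 <= p.2 / 2 & forall t, `|q.1 - t| <= q.2 -> ~ F n t].
have [f fP] : {f : nat * (R * R) -> R * R & forall np, P np (f np)}.
  apply: choice => -[n [y e]] /=.
  have [[Sy e0]|none] := pselect (S y /\ 0 < e); last first.
    by exists (0, 0) => Sy e0; exfalso; apply: none.
  have e20 : 0 < e / 2 by rewrite divr_gt0.
  have [t [St yt nFt]] := nd n y _ Sy e20.
  have [d' d'0 hd'] := cF n t nFt.
  exists (t, Num.min (d' / 2) (e / 2)) => _ _ /=.
  have m1 : Num.min (d' / 2) (e / 2) <= d' / 2 by rewrite ge_min lexx.
  have m2 : Num.min (d' / 2) (e / 2) <= e / 2 by rewrite ge_min lexx orbT.
  split => //; first by rewrite lt_min !divr_gt0.
  - lra.
  - move=> u tu; apply: hd'; lra.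
pose a := fix a n : R * R := if n is k.+1 then f (k, a k) else (x, d / 2).
have aP n : S (a n).1 /\ 0 < (a n).2.
  elim: n => [|n [Sn dn]] /=; first by rewrite divr_gt0.
  by have [] := fP (n, a n) Sn dn.
have step n : [/\ `|(a n).1 - (a n.+1).1| + (a n.+1).2 <= (a n).2,
    (a n.+1).2 <= (a n).2 / 2 & forall t, `|(a n.+1).1 - t| <= (a n.+1).2 -> ~ F n t].
  by have [Sn dn] := aP n; have [] := fP (n, a n) Sn dn.
have nest n k : `|(a n).1 - (a (n + k)%N).1| + (a (n + k)%N).2 <= (a n).2.
  elim: k => [|k IH]; first by rewrite addn0 subrr normr0 add0r.
  have [h _ _] := step (n + k)%N; rewrite addnS.
  have := ler_distD (a (n + k)%N).1 (a n).1 (a (n + k).+1).1; lra.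
have meet m n : (a m).1 - (a m).2 <= (a n).1 + (a n).2.
  have [_ am] := aP m; have [_ an] := aP n.
  have [mn|/ltnW nm] := leqP m n.
    have := nest m (n - m)%N; rewrite subnKC // => h.
    have := ler_norm ((a m).1 - (a n).1); lra.
  have := nest n (m - n)%N; rewrite subnKC // => h.
  have := ler_norm (- ((a n).1 - (a m).1)); rewrite normrN; lra.
pose L := [set (a n).1 - (a n).2 | n in [set: nat]].
pose l := sup L.
have l_ge n : (a n).1 - (a n).2 <= l.
  apply: ub_le_sup; last by exists n.
  by exists ((a 0).1 + (a 0).2) => _ [m _ <-]; exact: meet.
have l_le n : l <= (a n).1 + (a n).2.
  apply: ge_sup; first by exists ((a 0).1 - (a 0).2); exists 0.
  by move=> _ [m _ <-]; exact: meet.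
have la n : `|(a n).1 - l| <= (a n).2.
  rewrite ler_norml; have := l_ge n; have := l_le n; lra.
have small n : (a n).2 * n.+1%:R <= d / 2.
  elim: n => [|n IH]; first by rewrite mulr1.
  have [_ h _] := step n; have [_ an] := aP n.
  apply: le_trans IH; apply: (@le_trans _ _ ((a n).2 / 2 * n.+2%:R)).
    by rewrite ler_wpM2r.
  rewrite -mulrA ler_pM2l // mulrC ler_pdivrMr //.
  by rewrite -natrM ler_nat muln2 -addnn addnS ltnS leq_addr.
exists l; split.
- apply: eps_closed_adherent => // e e0.
  pose n := Num.trunc (d / 2 / e).
  have hn : d / 2 / e < n.+1%:R by exact: truncnS_gt.
  exists (a n).1; first by have [] := aP n.
  rewrite distrC; apply: le_lt_trans (la n) _.
  have := small n; rewrite ltr_pdivrMr // in hn => h.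
  have : (a n).2 * n.+1%:R < e * n.+1%:R by rewrite (mulrC e); exact: le_lt_trans hn.
  by rewrite ltr_pM2r // ltr0n.
- have := la 0; rewrite /=; lra.
- move=> n; have [_ _ h] := step n; apply: h; exact: la.
Qed.

(** A gap ]p, q[ of Q between x1 and x2 would leave ]G p, G q[ uncovered. *)
Lemma increasing_image_interval Q (G : R -> R) (g1 g2 : R) : eps_closed Q ->
  (forall x y, Q x -> Q y -> x < y -> G x < G y) -> g1 < g2 ->
  (forall g, g1 <= g <= g2 -> exists2 x, Q x & G x = g) ->
  exists x1 x2, x1 < x2 /\ forall x, x1 <= x <= x2 -> Q x.
Proof.
move=> cQ inc g12 img.
have [x1 Q1 G1] : exists2 x, Q x & G x = g1 by apply: img; rewrite lexx ltW.
have [x2 Q2 G2] : exists2 x, Q x & G x = g2 by apply: img; rewrite lexx ltW.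
have inc' x y : Q x -> Q y -> G x < G y -> x < y.
  move=> Qx Qy Gxy; have [//|yx|xy] := ltgtP x y.
    by have := lt_trans (inc _ _ Qy Qx yx) Gxy; rewrite ltxx.
  by move: Gxy; rewrite xy ltxx.
have x12 : x1 < x2 by apply: inc' => //; rewrite G1 G2.
exists x1, x2; split=> // x /andP[xx1 xx2]; apply: contrapT => nQx.
pose La := [set y | Q y /\ y <= x]; pose Lb := [set - y | y in [set y | Q y /\ x <= y]].
have supA : has_sup La by split; [exists x1 | exists x => y []].
have supB : has_sup Lb.
  split; first by exists (- x2); exists x2.
  by exists (- x) => _ [y [_ xy] <-]; rewrite lerN2.
pose p := sup La; pose q := - sup Lb.
have Qp : Q p.
  apply: eps_closed_adherent => // d d0.
  have [y [Qy yx] py] := sup_adherent d0 supA.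
  have yp : y <= p by apply: ub_le_sup => //; exact: supA.2.
  by exists y => //; rewrite ger0_norm ?subr_ge0 // -/p in py *; lra.
have Qq : Q q.
  apply: eps_closed_adherent => // d d0.
  have [_ [y [Qy yx] <-] py] := sup_adherent d0 supB.
  have yp : - y <= sup Lb by apply: ub_le_sup; [exact: supB.2 | exists y].
  by exists y => //; rewrite /q distrC ger0_norm; lra.
have px : p <= x by apply: ge_sup; [exact: supA.1 | move=> y []].
have xq : x <= q.
  rewrite /q lerNr; apply: ge_sup; first exact: supB.1.
  by move=> _ [y [_ xy] <-]; rewrite lerN2.
have pq : p < q.
  rewrite lt_neqAle (le_trans px xq) andbT; apply/eqP => pq.
  by apply: nQx; have -> : x = p by lra.
have Gpq := inc _ _ Qp Qq pq.
have x1p : x1 <= p by apply: ub_le_sup => //; exact: supA.2.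
have qx2 : q <= x2.
  by rewrite /q lerNl; apply: ub_le_sup; [exact: supB.2 | exists x2].
have mono x' y' : Q x' -> Q y' -> x' <= y' -> G x' <= G y'.
  move=> Qx' Qy'; rewrite le_eqVlt => /orP[/eqP->//|h].
  by apply: ltW; exact: inc.
have [z Qz Gz] : exists2 z, Q z & G z = (G p + G q) / 2.
  by apply: img; have := mono _ _ Q1 Qp x1p; have := mono _ _ Qq Q2 qx2; rewrite G1 G2; lra.
have [zx|xz] := leP z x.
  have zp : z <= p by apply: ub_le_sup => //; exact: supA.2.
  by have := mono _ _ Qz Qp zp; rewrite Gz; lra.
have qz : q <= z.
  rewrite /q lerNl; apply: ub_le_sup; first exact: supB.2.
  by exists z => //; split => //; exact: ltW.
by have := mono _ _ Qq Qz qz; rewrite Gz; lra.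
Qed.

Lemma lipschitz_image_closed Q (G : R -> R) (L a b : R) : eps_closed Q ->
  (forall x, Q x -> a <= x <= b) ->
  (forall x y, Q x -> Q y -> `|G x - G y| <= L * `|x - y|) ->
  closed (G @` Q).
Proof.
move=> cQ Qab lip; apply: compact_closed; first exact: Rhausdorff.
apply: continuous_compact.
  apply/subspace_continuousP => x Qx; apply/cvgrPdist_lt => e e0.
  have L0 : 0 < `|L| + 1 by rewrite ltr_wpDl.
  near=> t; have Qt : Q t by near: t; exact: withinT.
  have xt : `|x - t| < e / (`|L| + 1).
    near: t; apply: cvg_within; apply: nbhsx_ballx; exact: divr_gt0.
  apply: le_lt_trans (lip _ _ Qx Qt) _.
  apply: (@le_lt_trans _ _ ((`|L| + 1) * `|x - t|)).
    by rewrite ler_wpM2r //; have := ler_norm L; lra.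
  by rewrite mulrC -ltr_pdivlMr.
apply: (@subclosed_compact _ _ `[a, b]%classic); first by apply/eps_closedP.
  exact: segment_compact.
by move=> x /Qab; rewrite /= in_itv.
Unshelve. all: by end_near.
Qed.

(** Each point of E n has a neighbourhood in E n on which G separates it from
    the others, increasingly and at a definite rate, but the rate and the size
    of the neighbourhood depend on the point. Sorting the points by rate and
    cutting into short intervals yields countably many compact pieces on which
    G is increasing. The image of a piece is closed, and it contains no interval
    because the piece contains none. *)
Lemma meager_image (E : nat -> set R) (G : R -> R) (L : nat -> R) :
  (forall n, eps_closed (E n)) ->
  (forall n x y, E n x -> E n y -> `|G x - G y| <= L n * `|x - y|) ->
  (forall n x, E n x -> exists c d, [/\ 0 < c, 0 < d & forall y, E n y -> `|x - y| < d ->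
     c * `|x - y| <= (if x <= y then G y - G x else G x - G y)]) ->
  (forall n a b, a < b -> exists2 x, a <= x <= b & ~ E n x) ->
  exists F : nat -> set R, [/\ forall i, closed (F i),
    forall i a b, a < b -> exists2 g, a < g < b & ~ F i g &
    forall n x, E n x -> exists i, F i (G x)].
Proof.
move=> cE lip loc noI.
pose dl m : R := m.+1%:R^-1.
have dl0 m : 0 < dl m by rewrite invr_gt0 ltr0n.
pose P n m := [set x | E n x /\ forall y, E n y -> `|x - y| < dl m ->
   dl m * `|x - y| <= (if x <= y then G y - G x else G x - G y)].
pose J m (k : int) := [set x : R | k%:~R * (dl m / 2) <= x <= k%:~R * (dl m / 2) + dl m / 2].
pose Q (i : nat * nat * int) := let: (n, m, k) := i in P n m `&` J m k.
have cP n m : eps_closed (P n m).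
  apply: eps_closed_intro => x adh.
  have Ex : E n x.
    apply: eps_closed_adherent (cE n) _ => d d0.
    by have [t [Et _] xt] := adh d d0; exists t.
  split => // y Ey xy.
  have [->|yx] := eqVneq x y; first by rewrite lexx !subrr normr0 mulr0.
  have xy0 : 0 < `|x - y| by rewrite normr_gt0 subr_eq0.
  apply/ler_addgt0Pr => e e0.
  pose B := `|L n| + dl m.
  have B0 : 0 < B by rewrite ltr_wpDl.
  pose d := Num.min (Num.min `|x - y| (dl m - `|x - y|)) (e / B).
  have d0 : 0 < d by rewrite !lt_min xy0 subr_gt0 xy divr_gt0.
  have [t [Et ht] xt] := adh d d0.
  move: (xt); rewrite !lt_min => /andP[/andP[xt1 xt2] xt3].
  have ty : `|t - y| < dl m.
    have := ler_distD x t y; rewrite (distrC t x); lra.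
  have {ht} := ht y Ey ty.
  have xtB : `|x - t| * B < e by rewrite -ltr_pdivlMr.
  have lipL : `|G x - G t| <= `|L n| * `|x - t|.
    apply: le_trans (lip n x t Ex Et) _.
    by rewrite ler_wpM2r // ler_norm.
  have tri : dl m * `|x - y| <= dl m * (`|x - t| + `|t - y|).
    by rewrite ler_pM2l // ler_distD.
  have g1 := ler_norm (G x - G t).
  have g2 := ler_norm (- (G x - G t)); rewrite normrN in g2.
  have t1 := ler_norm (x - t).
  have t2 := ler_norm (- (x - t)); rewrite normrN in t2.
  rewrite /B in xtB.
  case: (leP x y) xt1 tri => cxy.
    rewrite (ler0_norm (x := x - y)) ?subr_le0 // => xt1 tri.
    have -> : t <= y by lra.
    lra.
  rewrite (gtr0_norm (x := x - y)) ?subr_gt0 // => xt1 tri.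
  have -> : (t <= y) = false by apply/negbTE; rewrite -ltNge; lra.
  lra.
have cJ m k : eps_closed (J m k).
  apply/eps_closedP; rewrite (_ : J m k =
    `[k%:~R * (dl m / 2), k%:~R * (dl m / 2) + dl m / 2]%classic).
    exact: interval_closed.
  by apply/seteqP; split=> x /=; rewrite in_itv.
have incQ n m k x y : Q (n, m, k) x -> Q (n, m, k) y -> x < y -> G x < G y.
  move=> [[Ex Px] Jx] [[Ey Py] Jy] xy.
  have dxy : `|x - y| < dl m.
    rewrite ltr0_norm ?subr_lt0 //; have := dl0 m.
    by move/andP: Jx => [? ?]; move/andP: Jy => [? ?]; lra.
  have := Px y Ey dxy; rewrite (ltW xy) => h.
  have : 0 < dl m * `|x - y| by rewrite mulr_gt0 // normr_gt0 subr_eq0 lt_eqF.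
  lra.
pose F i := if unpickle i is Some j then G @` (Q j) else set0.
exists F; split.
- move=> i; rewrite /F; case: unpickle => [[[n m] k]|]; last exact: closed0.
  apply: (@lipschitz_image_closed _ _ (L n)); first exact: eps_closedI.
    by move=> x [_ Jx]; exact: Jx.
  by move=> x y [[Ex _] _] [[Ey _] _]; exact: lip.
- move=> i a b ab; apply: contrapT => none.
  have all_F g : a < g < b -> F i g.
    by move=> gab; apply: contrapT => nF; apply: none; exists g.
  move: all_F; rewrite /F; case: unpickle => [[[n m] k]|] all_F; last first.
    by apply: (all_F ((a + b) / 2)); apply/andP; split; lra.
  have [|||g /andP[ga gb]|x1 [x2 [x12 x12Q]]] :=
    @increasing_image_interval (Q (n, m, k)) G ((2 * a + b) / 3) ((a + 2 * b) / 3).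
  + exact: eps_closedI.
  + exact: incQ.
  + lra.
  + have [|x Qx Gx] := all_F g; first by apply/andP; split; lra.
    by exists x.
  have [x xx nEx] := noI n x1 x2 x12.
  by apply: nEx; have [[]] := x12Q x xx.
move=> n x Ex; have [c [d [c0 d0 h]]] := loc n x Ex.
have cd0 : 0 < Num.min c d by rewrite lt_min c0.
have [m] := ltr_add_invr cd0; rewrite add0r lt_min => /andP[mc md].
pose k := Num.floor (x / (dl m / 2)).
have h2 : 0 < dl m / 2 by rewrite divr_gt0.
exists (pickle (n, m, k)); rewrite /F pickleK; exists x => //; split.
  split => // y Ey xy; apply: le_trans (h y Ey (lt_trans xy md)).
  by rewrite ler_wpM2r // ltW.
have /andP[k1 k2] := floor_itv (x / (dl m / 2)); rewrite -/k in k1 k2.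
rewrite /J /=; apply/andP; split; first by rewrite -ler_pdivlMr.
by move: k2; rewrite intrD ltr_pdivrMr // mulrDl mul1r => /ltW.
Qed.

End RealTopology.
(** * Exceptional points and boundary values *)
Section ExceptionalPoints.
Context {R : realType} {H : hilbertType R}.
Local Notation C := R[i].
Variables (A : @operator R H) (phi : H -> C).
Hypothesis A_sa : self_adjoint A.
Hypothesis phi_Hm2 : in_Hm2 A phi.
Hypothesis phi_sing : ~ in_H A phi.
Hypothesis phi_cyclic : cyclic_vector A (gen_resolvent A phi (- 'i)).
Let phi_lin : linear_on (dom A) (phi : H -> C^o).
Proof. by case: (Hm2_bound A_sa phi_Hm2). Qed.
Implicit Types (s t : R) (n : nat).

Definition phi_bounded n s :=
  forall x, dom A x -> nrm (phi x) <= n%:R * nrm (A x - s%:C%C *: x).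

(** A real s lies in some exceptional n as soon as it is a spectral point
    and an eigenvalue of a perturbation with nonzero coupling. *)
Definition exceptional n : set R := [set s | ~ regular A s /\ phi_bounded n s].

Lemma nonregular_closed : eps_closed [set s | ~ regular A s].
Proof.
move=> s /= /contrapT /regular_open[d d0 hd]; exists d => // t st; apply.
exact: hd.
Qed.

Lemma phi_bounded_closed n : eps_closed [set s | phi_bounded n s].
Proof.
apply: eps_closed_intro => s adh x Dx; apply/ler_addgt0Pr => e e0.
pose B := n%:R * nrm x + 1.
have B0 : 0 < B by rewrite ltr_wpDl // mulr_ge0 ?nrm_ge0.
have [t tb st] := adh (e / B) (divr_gt0 e0 B0).
apply: le_trans (tb x Dx) _.
have h : n%:R * nrm (A x - t%:C%C *: x) <= n%:R * (nrm (A x - s%:C%C *: x) + `|s - t| * nrm x).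
  by rewrite ler_wpM2l //; exact: nrm_shift_move.
have : `|s - t| * B <= e by rewrite -ler_pdivlMr // ltW.
have : 0 <= `|s - t| by [].
rewrite /B; lra.
Qed.

Lemma exceptional_closed n : eps_closed (exceptional n).
Proof. exact: (eps_closedI nonregular_closed (@phi_bounded_closed n)). Qed.

(** Otherwise the bound would hold on a whole neighbourhood of s in the spectrum,
    and local_regular would make s regular. *)
Lemma exceptional_nowhere_dense n s (d : R) : ~ regular A s -> 0 < d ->
  exists t, [/\ ~ regular A t, `|s - t| < d & ~ exceptional n t].
Proof.
move=> sreg d0; apply: contrapT => none; apply: sreg.
apply: (@local_regular _ _ _ A_sa _ _ phi_lin (cyclic_rE A_sa phi_Hm2) phi_cyclic
  s (d / 2) n%:R) => //; first by rewrite divr_gt0.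
move=> u us ureg x Dx.
suff : exceptional n u by case=> _; exact.
apply: contrapT => nu; apply: none; exists u; split => //.
by rewrite distrC; lra.
Qed.

Lemma exceptional_no_interval n (a b : R) : a < b ->
  exists2 s, a <= s <= b & ~ exceptional n s.
Proof.
move=> ab; apply: contrapT => none.
have all_s s : a <= s <= b -> exceptional n s.
  by move=> h; apply: contrapT => ns; apply: none; exists s.
have [|mreg _] := all_s ((a + b) / 2); first by apply/andP; split; lra.
have [|t [_ st]] := @exceptional_nowhere_dense n _ ((b - a) / 2) mreg; first lra.
apply; apply: all_s; move: st; rewrite ltr_norml => /andP[? ?]; apply/andP; split; lra.
Qed.

Local Notation sv := (sing_vec A phi).

(** The default value 0 is only met at points without a weak solution. *)
Definition sol s : H := xget 0 [set y | weak_sol A phi s y].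
(** A spectral point s is an eigenvalue for the coupling alpha <> 0 only if this is
    - 1 / alpha - c. *)
Definition boundary_value s : R := complex.Re (phi (sol s - sv)).

Lemma sol_eq s y : weak_sol A phi s y -> sol s = y.
Proof.
move=> sy; have h := xgetPex 0 (ex_intro _ y sy : exists y, weak_sol A phi s y).
exact: weak_sol_unique h sy.
Qed.

Lemma phi_bounded_sol n s : phi_bounded n s ->
  [/\ nrm (sol s) <= n%:R, weak_sol A phi s (sol s) &
    forall e : R, 0 < e -> exists2 x, dom A x & nrm (sol s - (A x - s%:C%C *: x)) < e].
Proof.
move=> sb; have [y [ny sy appr]] := weak_sol_exists A_sa phi_Hm2 (ler0n R n) sb.
by rewrite (sol_eq sy).
Qed.

Lemma boundary_value_sub n m s t : phi_bounded n s -> phi_bounded m t ->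
  boundary_value s - boundary_value t = (s - t) * complex.Re (inner (sol s) (sol t)).
Proof.
move=> /phi_bounded_sol[_ ss _] /phi_bounded_sol[_ st _].
have [_ _ E] := weak_sol_sub A_sa phi_Hm2 ss st.
have D1 := weak_sol_dom A_sa phi_Hm2 ss; have D2 := weak_sol_dom A_sa phi_Hm2 st.
rewrite /boundary_value -cRe_opp -cRe_add.
have [_ <-] := linear_onB phi_lin D1 D2.
have -> : sol s - sv - (sol t - sv) = sol s - sol t.
  by rewrite opprB addrA subrK.
by rewrite E cRe_mulr.
Qed.

Lemma boundary_value_lipschitz n s t : exceptional n s -> exceptional n t ->
  `|boundary_value s - boundary_value t| <= n%:R ^+ 2 * `|s - t|.
Proof.
move=> [_ sb] [_ tb]; rewrite (boundary_value_sub sb tb) normrM mulrC ler_wpM2r //.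
have [ns _ _] := phi_bounded_sol sb; have [nt _ _] := phi_bounded_sol tb.
apply: (@le_trans _ _ (nrm (sol s) * nrm (sol t))).
  rewrite ler_norml; apply/andP; split; last exact: Re_inner_le.
  by rewrite lerNl -cRe_opp -innerNl -(nrmN (sol s)); exact: Re_inner_le.
by rewrite expr2 ler_pM ?nrm_ge0.
Qed.

Lemma sol_neq0 n s : phi_bounded n s -> 0 < nrm (sol s).
Proof.
move=> /phi_bounded_sol[_ ss _]; rewrite lt_def nrm_ge0 andbT nrm_eq0.
apply/eqP => s0; apply: phi_sing; exists 0 => x Dx.
by rewrite -(ss x Dx) s0 !inner0l.
Qed.

(** The difference quotients of boundary_value are Re <sol s, sol t>, which tends
    to |sol s|^2 > 0 as t tends to s inside exceptional n: sol t is bounded there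
    and sol s is a limit of vectors p = (A - s)x, for which
    <sol t - sol s, p> = (t - s) <sol t, x>. *)
Lemma boundary_value_increasing n s : exceptional n s -> exists c d : R,
  [/\ 0 < c, 0 < d & forall t, exceptional n t -> `|s - t| < d ->
    c * `|s - t| <= if s <= t then boundary_value t - boundary_value s else boundary_value s - boundary_value t].
Proof.
move=> [_ sb]; have y0 := sol_neq0 sb; have [ny sy yapp] := phi_bounded_sol sb.
set y := sol s in y0 ny sy yapp.
pose c := nrm y ^+ 2 / 2.
have c0 : 0 < c by rewrite divr_gt0 // exprn_gt0.
have n0 : 0 <= n%:R :> R by [].
pose eps := c / (4 * n%:R + 1).
have N0 : 0 < 4 * n%:R + 1 :> R by lra.
have eps0 : 0 < eps by rewrite divr_gt0.
have [x Dx yx] := yapp eps eps0.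
pose B := n%:R * nrm x * 2 + 1.
have nx := nrm_ge0 x.
have B0 : 0 < B by rewrite ltr_wpDl // mulr_ge0 // mulr_ge0.
exists c, (c / B); split => //; first exact: divr_gt0.
move=> t [_ tb] st; have [ny' sy' _] := phi_bounded_sol tb.
have key : c <= complex.Re (inner y (sol t)).
  set y' := sol t in ny' sy' *; set p := A x - s%:C%C *: x in yx.
  have pE : inner (y' - y) p = (t - s)%:C%C * inner y' x.
    rewrite /p innerDl innerNl (sy x Dx) -(sy' x Dx) !innerDr !innerNr !innerZr.
    rewrite rmorphB /=; ring.
  have e1 : complex.Re (inner y y') = nrm y ^+ 2
      + complex.Re (inner (y' - y) (y - p)) + complex.Re (inner (y' - y) p).
    rewrite -addrA -cRe_add -innerDr subrK (Re_innerC (y' - y)) nrm2E -cRe_add.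
    by rewrite -innerDr addrC subrK.
  have dy : nrm (y' - y) <= 2 * n%:R by have := nrmD y' (- y); rewrite nrmN; lra.
  have e2 : - complex.Re (inner (y' - y) (y - p)) <= 2 * n%:R * eps.
    rewrite -cRe_opp -innerNl; apply: le_trans (Re_inner_le _ _) _.
    by rewrite nrmN ler_pM ?nrm_ge0 // ltW.
  have e3 : - complex.Re (inner (y' - y) p) <= `|s - t| * (n%:R * nrm x).
    rewrite -cRe_opp; apply: le_trans (Re_le_nrm _) _.
    rewrite nrmN pE nrmM nrm_real distrC ler_wpM2l //.
    by apply: le_trans (inner_le_nrm _ _) _; rewrite ler_wpM2r.
  have e4 : eps * (4 * n%:R + 1) = c by rewrite /eps divfK // gt_eqF.
  have e5 : `|s - t| * B <= c by rewrite -ler_pdivlMr // ltW.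
  have e6 : nrm y ^+ 2 = c * 2 by rewrite /c divfK // pnatr_eq0.
  have e7 : 0 <= `|s - t| by [].
  rewrite /B in e5; lra.
have E := boundary_value_sub sb tb; rewrite -/y in E.
case: (leP s t) => cst.
  have -> : boundary_value t - boundary_value s = (t - s) * complex.Re (inner y (sol t)).
    by rewrite -opprB E -mulNr opprB.
  by rewrite ler0_norm ?subr_le0 // opprB mulrC ler_wpM2l // subr_ge0.
rewrite E gtr0_norm ?subr_gt0 // mulrC ler_wpM2l // subr_ge0; exact: ltW.
Qed.

Lemma eigenvalue_exceptional (c alpha : R) (z : C) : alpha != 0 ->
  spectrum A z -> point_spectrum (rank_one_pert A phi c alpha) z ->
  exists s n, [/\ z = s%:C%C, exceptional n s & boundary_value s = - alpha^-1 - c].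
Proof.
move=> alpha0 /(spectrumP A_sa)[s -> sreg].
move=> /(eigenvalue_weak_sol A_sa phi_Hm2 phi_sing phi_cyclic alpha0)[y sy E].
pose n := (Num.trunc (nrm y)).+1.
have nn : nrm y < n%:R by exact: truncnS_gt.
exists s, n; split => //.
  split => // x Dx; apply: le_trans (weak_sol_bound sy Dx) _.
  by rewrite ler_wpM2r ?nrm_ge0 // ltW.
rewrite /boundary_value (sol_eq sy).
have := congr1 (@complex.Re R) E; rewrite cRe_add cRe_mulr cRe_add /= => h.
have -> : complex.Re (phi (y - sv)) = (alpha * (complex.Re (phi (y - sv)) + c)) / alpha - c.
  by rewrite mulrAC divff // mul1r addrK.
have -> : alpha * (complex.Re (phi (y - sv)) + c) = -1 by lra.
by rewrite mulN1r.
Qed.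

Lemma Re_preimage_open (U : set R) : open U ->
  open [set z : C^o | U (complex.Re z)].
Proof.
rewrite !openE => oU z /= /oU[d /= d0 hd].
apply/nbhs_ballP; exists d%:C%C; first by rewrite /= ltcR.
move=> t; rewrite -ball_normE /ball_ /= nrmC ltcR => zt; apply: hd => /=.
apply: le_lt_trans zt; rewrite -cRe_opp -cRe_add.
rewrite ler_norml Re_le_nrm andbT lerNl -cRe_opp -nrmN; exact: Re_le_nrm.
Qed.

(** The exceptional sets are closed and nowhere dense in the spectrum. *)
Lemma noneigenvalues_residual (c : R) : contains_dense_Gdelta_of (spectrum A)
    [set z | spectrum A z /\ forall alpha : R, alpha != 0 ->
         ~ point_spectrum (rank_one_pert A phi c alpha) z].
Proof.
exists (\bigcap_n [set z : C^o | ~ exceptional n (complex.Re z)]); split.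
- exists (fun n => [set z : C^o | ~ exceptional n (complex.Re z)]) => // n.
  by apply: (@Re_preimage_open (~` exceptional n)); rewrite openC; apply/eps_closedP; exact: exceptional_closed.
- move=> z [zs zU]; split=> // alpha alpha0 zp.
  have [s [n [zE es _]]] := eigenvalue_exceptional alpha0 zs zp.
  by apply: (zU n) => //; rewrite zE.
move=> z zs; have [s zE sreg] := spectrumP A_sa zs.
move=> W /nbhs_ballP[e /= e0 We].
have eE : e = (complex.Re e)%:C%C by rewrite RRe_real // gtr0_real.
have d0 : 0 < complex.Re e by rewrite -ltcR -eE.
have [t [treg st nt]] := baire_closed nonregular_closed exceptional_closed
  exceptional_nowhere_dense sreg d0.
exists t%:C%C; split; first by split; [exact: spectrum_real | move=> n _; exact: nt].
by apply: We; rewrite -ball_normE /ball_ /= nrmC eE ltcR zE -rmorphB nrm_real.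
Qed.

(** The bad couplings, apart from 0, are the preimages under
    alpha |-> - 1 / alpha - c of the boundary values at exceptional points. *)
Lemma couplings_residual (c : R) : contains_dense_Gdelta_of [set: R]
    [set alpha : R | point_spectrum (rank_one_pert A phi c alpha) `&` spectrum A = set0].
Proof.
have [F [cF nF EF]] := meager_image exceptional_closed boundary_value_lipschitz
  boundary_value_increasing exceptional_no_interval.
pose V i := [set a : R | a != 0 /\ ~ F i (- a^-1 - c)].
have oV i : open (V i).
  rewrite openE => a [a0 nFa].
  have oF : open (~` F i) by rewrite openC.
  have ca : (fun x : R => - x^-1 - c) @ a --> - a^-1 - c.
    by apply: cvgB; [apply: cvgN; apply: cvgV | exact: cvg_cst].
  have h1 : \forall x \near a, ~ F i (- x^-1 - c).
    have := ca (~` F i); apply; exact: (open_nbhs_nbhs (conj oF nFa)).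
  have h2 : \forall x \near a, x != 0 :> R.
    have : open [set x : R | x != 0] by exact: open_neq.
    by rewrite openE; exact.
  by near=> x; split; near: x.
exists (\bigcap_i V i); split.
- by exists V.
- move=> a [_ aV]; rewrite /= -subset0 => z [zp zs].
  have [a0 _] := aV 0 I.
  have [s [n [_ es E]]] := eigenvalue_exceptional a0 zs zp.
  case: (EF n s es) => i; rewrite E => Fi.
  by case: (aV i I) => _; apply.
move=> a _ W /nbhs_ballP[d /= d0 Wd].
have [||n x e _ e0|t [_ ad tV]] := @baire_closed R setT (fun i => ~` V i) _ _ _ a d I d0.
- by move=> x /(_ I).
- by move=> i; apply/eps_closedP; rewrite -openC setCK.
- have [p [q [pq pq0 xp xq]]] : exists p q : R,
      [/\ p < q, 0 < p * q, x - e < p & q < x + e].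
    have [x0|x0] := leP 0 x.
      by exists (x + e / 4), (x + e / 2); split; try (apply: mulr_gt0); lra.
    exists (x - e / 2), x; split; try lra.
    by rewrite nmulr_rgt0 //; lra.
  have [p0 q0] : p != 0 /\ q != 0.
    by split; apply/eqP => h; move: pq0; rewrite h ?mulr0 ?mul0r ltxx.
  have inv_lt : - p^-1 - c < - q^-1 - c.
    rewrite ltrD2r ltrN2 -subr_gt0.
    have -> : p^-1 - q^-1 = (q - p) / (p * q) by field; rewrite p0 q0.
    by rewrite divr_gt0 // subr_gt0.
  have [g /andP[g1 g2] nFg] := nF n _ _ inv_lt.
  have same_sign : 0 < p /\ 0 < q \/ p < 0 /\ q < 0.
    have [p1|p1] := ltP 0 p; [left|right].
      by split => //; rewrite -(pmulr_rgt0 _ p1).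
    have p2 : p < 0 by rewrite lt_def eq_sym p0.
    by split => //; rewrite -(nmulr_rgt0 _ p2).
  (* alpha |-> - 1 / alpha increases on each side of 0. *)
  have inv_neg (u v : R) : 0 < u /\ 0 < v \/ u < 0 /\ v < 0 ->
      (- u^-1 < - v^-1) = (u < v).
    move=> [[u0 v0]|[u0 v0]]; rewrite ltrN2; first by rewrite ltf_pV2.
    by rewrite ltf_nV2.
  pose t := - (g + c)^-1.
  have tE : - t^-1 = g + c by rewrite /t invrN invrK opprK.
  have sg : 0 < p /\ 0 < t /\ 0 < q \/ p < 0 /\ t < 0 /\ q < 0.
    case: same_sign => [[p1 q1]|[p1 q1]]; [left|right]; do !split => //.
      rewrite /t oppr_gt0 invr_lt0.
      have : q^-1 > 0 by rewrite invr_gt0.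
      lra.
    rewrite /t oppr_lt0 invr_gt0.
    have : p^-1 < 0 by rewrite invr_lt0.
    lra.
  have pt : p < t.
    rewrite -inv_neg; first by rewrite tE; lra.
    by case: sg => [[? [? ?]]|[? [? ?]]]; [left|right].
  have tq : t < q.
    rewrite -inv_neg; first by rewrite tE; lra.
    by case: sg => [[? [? ?]]|[? [? ?]]]; [left|right].
  exists t; split => //; first by rewrite ltr_norml; apply/andP; split; lra.
  apply; split; last by rewrite tE addrK.
  by case: sg => [[_ [/lt0r_neq0]]|[_ [/ltr0_neq0]]].
exists t; split; first by split=> // i _; apply: contrapT => /tV.
by apply: Wd.
Unshelve. all: by end_near.
Qed.

End ExceptionalPoints.

Theorem corollary5p19 (R : realType) (H : hilbertType R)
    (A : @operator R H) (phi : H -> R[i]) (c : R)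
    (A_sa : self_adjoint A)
    (phi_Hm2 : in_Hm2 A phi) (phi_sing : ~ in_H A phi)
    (phi_cyclic : cyclic_vector A (gen_resolvent A phi (- 'i))) :
  contains_dense_Gdelta_of (spectrum A)
    [set x | spectrum A x /\
       forall alpha : R, alpha != 0 ->
         ~ point_spectrum (rank_one_pert A phi c alpha) x]
  /\
  contains_dense_Gdelta_of [set: R]
    [set alpha : R |
       point_spectrum (rank_one_pert A phi c alpha) `&` spectrum A = set0].
Proof.
by split; [exact: noneigenvalues_residual | exact: couplings_residual].
Qed.
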